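(* Let $D_{in}$ be an arbitrary positive integer, let $\rho:\mathbb{R}\to\mathbb{R}$ be a piecewise $C^1$ function with $\rho'\in BV(\mathbb{R})$, and let $\epsilon>0$. Then there exists a meromorphic function $\sigma:\mathcal{D}\to\mathbb{C}$, defined on an open set $\mathcal{D}\subset\mathbb{C}$ with $\mathcal{D}\supset\mathbb{R}$, with $\sigma(\mathbb{R})\subset\mathbb{R}$ and $\|\rho-\sigma\|_{L^\infty(\mathbb{R})}<\epsilon$, with the following property: whenever $\mathcal{N}_1,\dots,\mathcal{N}_n$ are pairwise non-isomorphic (with respect to $\simeq$) neural networks in $\mathscr{N}^{D_{in},1}_{nc}$, the set $\{\mathcal{N}_j^\sigma\}_{j=1}^n\cup\{\mathbf{1}\}$ is a linearly independent set of functions $\mathbb{R}^{D_{in}}\to\mathbb{R}$, where $\mathbf{1}$ is the constant function with value $1$.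
   Context: $BV(\mathbb{R})=\{f\in L^1(\mathbb{R}): \sup\{\int_\mathbb{R} f\varphi'\,dx : \varphi\in C^1_c(\mathbb{R}),\ \|\varphi\|_{L^\infty}\le 1\}<\infty\}$. A neural network is a tuple $\mathcal{N}=(D_0,D_1,\dots,D_L;W^1,\theta^1,\dots,W^L,\theta^L)$ where $L\ge1$ is an integer, $D_0,\dots,D_L$ are positive integers (the layout), $W^\ell\in\mathbb{R}^{D_\ell\times D_{\ell-1}}$ and $\theta^\ell\in\mathbb{R}^{D_\ell}$, and no $W^\ell$ has an identically zero row or an identically zero column. For a nonlinearity $\rho:\mathbb{R}\to\mathbb{R}$ the map realized by $\mathcal{N}$ is $\mathcal{N}^\rho:\mathbb{R}^{D_0}\to\mathbb{R}^{D_L}$, $\mathcal{N}^\rho(x)=\rho(W^L(\rho(W^{L-1}(\cdots\rho(W^1x+\theta^1)\cdots)+\theta^{L-1}))+\theta^L)$, with $\rho$ acting componentwise (here $\sigma$ acts via its restriction to $\mathbb{R}$). $\mathscr{N}^{D_{in},1}_{nc}$ is the set of all neural networks with $D_0=D_{in}$, $D_L=1$ (depth and other layout entries arbitrary) that satisfy the no-clones condition: there are no $\ell$ and $j\neq j'$ with $(\theta^\ell_j,W^\ell_{j1},\dots,W^\ell_{jD_{\ell-1}})=(\theta^\ell_{j'},W^\ell_{j'1},\dots,W^\ell_{j'D_{\ell-1}})$. $\mathcal{N}\simeq\widetilde{\mathcal{N}}$ means: $L=\widetilde L$, same layout, and there are permutations $\gamma_\ell$ of $\{1,\dots,D_\ell\}$,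 with $\gamma_0,\gamma_L$ the identity, such that $\widetilde W^\ell_{jk}=W^\ell_{\gamma_\ell(j)\gamma_{\ell-1}(k)}$ and $\widetilde\theta^\ell_j=\theta^\ell_{\gamma_\ell(j)}$ for all $\ell,j,k$. *)

(* Defs.v *)
From HB Require Import structures.
From mathcomp Require Import all_boot all_order all_fingroup all_algebra.
From mathcomp Require Import all_classical all_reals all_analysis.
From mathcomp Require Import complex.

Set Implicit Arguments.
Unset Strict Implicit.
Unset Printing Implicit Defensive.
Import Order.TTheory GRing.Theory Num.Theory.
Import numFieldNormedType.Exports.

Local Open Scope ring_scope.
Local Open Scope classical_set_scope.
Local Open Scope complex_scope.

(* The breakpoints are locally finite, [f] is continuous across them, and the
   derivative has finite one-sided limits there; by the mean value theorem this
   says that [f] is C^1 on each closed piece. *)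
Definition piecewise_C1 (R : realType) (f : R -> R) : Prop :=
  continuous f /\
  exists S : set R,
    [/\ forall a b : R, finite_set (S `&` `[a, b]),
        forall x, ~ S x -> derivable f x 1 /\ {for x, continuous f^`()} &
        forall s, S s ->
          cvg (f^`() x @[x --> s^'-]) /\ cvg (f^`() x @[x --> s^'+])].

Definition C1c (R : realType) (phi : R -> R) : Prop :=
  [/\ forall x, derivable phi x 1, continuous phi^`() &
      compact (closure [set x | phi x != 0])].

Definition norm_Linfty (R : realType) (f : R -> R) : \bar R :=
  Lnorm (@lebesgue_measure R) +oo%E (EFin \o f).

(* Invariant under modification of [f] on a null set, so that it may be applied
   to a derivative which exists only outside a null set. *)
Definition BV_line (R : realType) (f : R -> R) : Prop :=
  (@lebesgue_measure R).-integrable setT (EFin \o f) /\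
  (ereal_sup [set (\int[@lebesgue_measure R]_x (f x * derive1 phi x)%:E)%E
             | phi in [set phi : R -> R | C1c phi /\ (norm_Linfty phi <= 1)%E]]
   < +oo)%E.

(* [R[i]^o] is [R[i]] as a normed space over itself: its topology is that of the
   modulus, and [derivable f z 1] over it is complex differentiability at [z]. *)
Definition holomorphic_at (R : realType) (f : R[i]^o -> R[i]^o) (z : R[i]^o) :
    Prop :=
  \forall w \near z, derivable f w 1.

Definition pole (R : realType) (f : R[i]^o -> R[i]^o) (p : R[i]^o) : Prop :=
  exists (m : nat) (g : R[i]^o -> R[i]^o),
    [/\ (0 < m)%N, holomorphic_at g p, g p != 0 &
        \forall z \near p^', f z = g z / (z - p) ^+ m].

(* [f] is meromorphic on [D] with set of poles [P]; the values of the total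
   function [f] at the poles and outside [D] are irrelevant. *)
Definition meromorphic (R : realType) (D P : set R[i]^o)
    (f : R[i]^o -> R[i]^o) : Prop :=
  [/\ open D, P `<=` D,
      forall z, D z -> ~ limit_point P z,
      forall z, D z -> ~ P z -> holomorphic_at f z &
      forall p, P p -> pole f p].

(* [weight l] and [bias l] are W^(l+1) and theta^(l+1), for l = 0, ..., L - 1
   with L = (size layout).-1; for l >= L they have no rows, so they carry no
   spurious data. *)
Record network (R : realType) := Network {
  layout : seq nat;
  weight : forall l : nat, 'M[R]_(nth 0%N layout l.+1, nth 0%N layout l);
  bias : forall l : nat, 'cV[R]_(nth 0%N layout l.+1);
  depth_ge1 : (1 <= (size layout).-1)%N;
  layout_gt0 : forall d, d \in layout -> (0 < d)%N;
  weight_row_neq0 : forall l j, (l < (size layout).-1)%N ->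
    row j (weight l) != 0;
  weight_col_neq0 : forall l k, (l < (size layout).-1)%N ->
    col k (weight l) != 0
}.

Definition depth (R : realType) (N : network R) : nat := (size (layout N)).-1.

Definition width (R : realType) (N : network R) (l : nat) : nat :=
  nth 0%N (layout N) l.

Fixpoint layer_output (R : realType) (rho : R -> R) (N : network R)
    (x : 'cV[R]_(width N 0)) (l : nat) : 'cV[R]_(width N l) :=
  match l return 'cV[R]_(width N l) with
  | 0%N => x
  | k.+1 => map_mx rho (weight N k *m layer_output rho x k + bias N k)
  end.

Definition realization (R : realType) (rho : R -> R) (N : network R)
    (x : 'cV[R]_(width N 0)) : 'cV[R]_(width N (depth N)) :=
  layer_output rho x (depth N).

Definition no_clones (R : realType) (N : network R) : Prop :=
  forall (l : nat) (j j' : 'I_(width N l.+1)), (l < depth N)%N -> j != j' ->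
    (bias N l j 0, row j (weight N l)) <> (bias N l j' 0, row j' (weight N l)).

Record nc_network (R : realType) (Din : nat) := NcNetwork {
  nc_net :> network R;
  width_in : width nc_net 0 = Din;
  width_out : width nc_net (depth nc_net) = 1%N;
  nc_no_clones : no_clones nc_net
}.

Definition nc_realization (R : realType) (Din : nat) (rho : R -> R)
    (N : nc_network R Din) (x : 'cV[R]_Din) : R :=
  castmx (width_out N, erefl 1%N)
    (realization rho (castmx (esym (width_in N), erefl 1%N) x)) 0 0.

Definition isomorphic (R : realType) (N N' : network R) : Prop :=
  exists (eqD : layout N = layout N') (gamma : forall l, {perm 'I_(width N l)}),
    let cast l : 'I_(width N l) -> 'I_(width N' l) :=
      cast_ord (congr1 (fun D => nth 0%N D l) eqD) in
    [/\ gamma 0%N = 1%g, gamma (depth N) = 1%g &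
        forall l, (l < depth N)%N -> forall j : 'I_(width N l.+1),
          bias N' l (cast l.+1 j) 0 = bias N l (gamma l.+1 j) 0 /\
          forall k : 'I_(width N l),
            weight N' l (cast l.+1 j) (cast l k) =
            weight N l (gamma l.+1 j) (gamma l k)].

Definition linearly_independent (K : fieldType) (V : lmodType K) (I : finType)
    (f : I -> V) : Prop :=
  forall c : I -> K, \sum_i c i *: f i = 0 -> forall i, c i = 0.

Definition with_one (R : realType) (Din n : nat)
    (f : 'I_n -> 'cV[R]_Din -> R^o) (o : option 'I_n) : 'cV[R]_Din -> R^o :=
  if o is Some j then f j else fun=> 1.

(* Main.v *)
Require Import Defs.
From HB Require Import structures.
From mathcomp Require Import all_boot all_order all_fingroup all_algebra.
From mathcomp Require Import all_classical all_reals all_analysis.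
From mathcomp Require Import complex ess_sup_inf ring lra.

Set Implicit Arguments.
Unset Strict Implicit.
Unset Printing Implicit Defensive.
Import Order.TTheory GRing.Theory Num.Theory.
Import numFieldNormedType.Exports.

Local Open Scope ring_scope.
Local Open Scope classical_set_scope.
Local Open Scope complex_scope.

(** [sigma] is chosen without poles: holomorphic on a strip around the real line
and generic in the following sense. A finite system of equations
[y_q = sigma (a_q)], where the [a_q] are pairwise distinct and the [a_q], [y_q]
are given locally Lipschitz functions of fewer real parameters than there are
equations, has no solution. Countably many systems suffice. On a cube of
parameters on which the [a_q] stay separated, such a system is destroyed with a
positive margin by an arbitrarily small perturbation
[sum_j v_j x^j / (1 + x^2)^n]: by interpolation a parameter determines [v] up to
a small error, and there are more grid values of [v] than cells of parameters.
Perturbations of rapidly decreasing size, added to a sum of smoothed steps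
[(x - t) / sqrt (d^2 + (x - t)^2)] approximating [rho], give [sigma]; bounds on
the first two divided differences pass to the limit and make it holomorphic.

A linear relation between 1, the coordinates and the [sigma \o b] for distinct
nonconstant preactivations [b], on some open set, contradicts genericity: at [M]
rational sample points it gives [M] equations more than there are unknown unit
values, and [M] may exceed the number of weights. Openness lets the induction
along the units produce sample points at which all preactivations differ.
Hence a preactivation determines its bias, its weights and the preactivations of
the previous layer, so equal outputs force isomorphic networks. *)

(** * Lagrange interpolation *)

Definition lagrange_poly (F : fieldType) (Q : finType) (a : Q -> F) (q : Q) :
    {poly F} :=
  \prod_(q' | q' != q) ((a q - a q')^-1 *: ('X - (a q')%:P)).

Lemma size_lagrange_poly (F : fieldType) (Q : finType) (a : Q -> F) (q : Q) :
  (size (lagrange_poly a q) <= #|Q|)%N.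
Proof.
have Q_gt0 : (0 < #|Q|)%N by apply/card_gt0P; exists q.
rewrite (leq_trans (size_prod_leq _ _)) // leq_subLR cardC1.
rewrite -[X in (_ < _ + X)%N](prednK Q_gt0) addnS ltnS addnn -mul2n mulnC.
rewrite -(cardC1 q) -sum_nat_const; apply: leq_sum => q' _.
by rewrite (leq_trans (size_scale_leq _ _)) // size_XsubC.
Qed.

Lemma horner_lagrange_poly (F : fieldType) (Q : finType) (a : Q -> F)
    (q q0 : Q) :
  injective a -> (lagrange_poly a q).[a q0] = (q0 == q)%:R.
Proof.
move=> a_inj; rewrite horner_prod; have [->|neq] := eqVneq q0 q.
  rewrite big1 // => q' neq'; rewrite hornerZ hornerXsubC mulVf //.
  by rewrite subr_eq0 inj_eq // eq_sym.
by rewrite (bigD1 q0) //= hornerZ hornerXsubC subrr mulr0 mul0r.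
Qed.

Lemma lagrange_interpolation (F : fieldType) (Q : finType) (a : Q -> F)
    (p : {poly F}) : injective a -> (size p <= #|Q|)%N ->
  p = \sum_q p.[a q] *: lagrange_poly a q.
Proof.
move=> a_inj size_p; apply/eqP; rewrite -subr_eq0; apply/eqP.
apply: (@roots_geq_poly_eq0 _ _ [seq a q | q <- enum Q]).
- apply/allP => _ /mapP[q _ ->]; rewrite /root hornerD hornerN subr_eq0.
  rewrite horner_sum (bigD1 q) //= hornerZ horner_lagrange_poly // eqxx mulr1.
  rewrite big1 ?addr0 // => q' neq.
  by rewrite hornerZ horner_lagrange_poly // eq_sym (negbTE neq) mulr0.
- by rewrite map_inj_uniq ?enum_uniq.
rewrite size_map -cardE (leq_trans (size_polyD _ _)) // size_polyN.
rewrite geq_max size_p; apply: (leq_trans (size_sum _ _ _)).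
apply/bigmax_leqP => q _.
exact: leq_trans (size_scale_leq _ _) (size_lagrange_poly a q).
Qed.

Lemma norm_coef_prod_XsubC (R : numDomainType) (I : finType) (P : pred I)
    (c a : I -> R) (A B : R) (j : nat) : 0 <= A ->
  (forall i, P i -> `|c i| <= B) -> (forall i, P i -> `|a i| <= A) ->
  `|(\prod_(i | P i) (c i *: ('X - (a i)%:P)))`_j| <= (B * (1 + A)) ^+ #|P|.
Proof.
move=> A0 cB aA; rewrite -prodr_const; move: j.
elim/big_rec2: _ => [j|i y p Pi IH j].
  by rewrite coef1; case: eqP => _; rewrite ?normr1 ?normr0.
rewrite -scalerAl coefZ normrM -mulrA ler_pM ?cB // mulrBl coefB mulrDl mul1r.
rewrite (le_trans (ler_normB _ _)) // lerD //.
  rewrite -commr_polyX coefMX; case: eqP => [_|_]; last exact: IH.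
  by rewrite normr0 (le_trans (normr_ge0 _) (IH 0%N)).
by rewrite coefCM normrM ler_pM ?aA.
Qed.

Definition cube (R : numDomainType) (T : Type) (l : R) (t : T -> R) : Prop :=
  forall i, `|t i| <= l.

Definition separated (R : numDomainType) (T : eqType) (l : R) (a : T -> R) :
  Prop :=
  forall i j, i != j -> l <= `|a i - a j|.

Lemma separated_inj (R : numDomainType) (T : eqType) (l : R) (a : T -> R) :
  0 < l -> separated l a -> injective a.
Proof.
move=> l0 sep i j aij; apply/eqP; apply: contraTT l0 => /sep.
by rewrite aij subrr normr0 => /le_gtF ->.
Qed.

Lemma interpolation_bound (R : numFieldType) (Q : finType) (A l e : R)
    (a : Q -> R) (p : {poly R}) (j : nat) :
  0 <= A -> 0 < l -> cube A a -> separated l a -> (size p <= #|Q|)%N ->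
  cube e (fun q => p.[a q]) ->
  `|p`_j| <= #|Q|%:R * (l^-1 * (1 + A)) ^+ #|Q|.-1 * e.
Proof.
move=> A0 l0 aA sep size_p pe.
rewrite {1}(lagrange_interpolation (separated_inj l0 sep) size_p) coef_sum.
rewrite (le_trans (ler_norm_sum _ _ _)) //.
rewrite -mulrA mulr_natl -sumr_const; apply: ler_sum => q _.
rewrite coefZ normrM mulrC ler_pM ?pe // -(cardC1 q).
apply: norm_coef_prod_XsubC => // q'; rewrite eq_sym => /sep lq.
by rewrite normfV lef_pV2 // posrE (lt_le_trans l0).
Qed.

(** * Counting dimensions *)

(* The cells of side [h] number [(k * m) ^ #|T|], fewer than the [m ^ n] points. *)
Lemma grid_pigeonhole (R : archiRealFieldType) (T : finType) (n m k : nat)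
    (l h : R) (t : {ffun 'I_n -> 'I_m} -> T -> R) :
  0 < h -> 2 * l < (k * m)%:R * h -> (#|T| < n)%N -> (k ^ #|T| < m)%N ->
  (forall g, cube l (t g)) ->
  exists g g', g != g' /\ cube h (t g - t g').
Proof.
move=> h0 lh Tn km tl.
have cell_ge0 g i : 0 <= (t g i + l) / h.
  rewrite divr_ge0 ?(ltW h0) // -lerBlDr sub0r.
  by case/ler_normlP: (tl g i); rewrite lerNl.
have cell_lt g i : (Num.truncn ((t g i + l) / h) < k * m)%N.
  rewrite -(ltr_nat R) (le_lt_trans (_ : _ <= (t g i + l) / h)) ?truncn_le //.
  rewrite ltr_pdivrMr // (le_lt_trans _ lh) // mulr_natl mulr2n lerD2r.
  exact: le_trans (ler_norm _) (tl g i).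
pose cell g : {ffun T -> 'I_(k * m)} := [ffun i => Ordinal (cell_lt g i)].
have not_inj : ~ injective cell.
  move=> /leq_card; rewrite !card_ffun !card_ord leqNgt => /negP; apply.
  have m0 : (0 < m)%N by exact: leq_ltn_trans km.
  apply: (@leq_trans (m ^ #|T|.+1)); last by rewrite leq_pexp2l.
  by rewrite expnMn expnS ltn_pmul2r // expn_gt0 m0.
move: not_inj => /existsNP[g /existsNP[g' /not_implyP[gg' /eqP neq]]].
exists g, g'; split=> // i.
have := congr1 (fun c : {ffun T -> 'I_(k * m)} => val (c i)) gg'.
rewrite !ffunE /= => truncn_eq.
have -> : (t g - t g') i = ((t g i + l) / h - (t g' i + l) / h) * h.
  by rewrite !fctE; field; rewrite gt_eqF.
rewrite normrM (gtr0_norm h0) ler_piMl ?(ltW h0) //.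
have := truncn_itv (cell_ge0 g i); have := truncn_itv (cell_ge0 g' i).
rewrite truncn_eq -natr1 => /andP[? ?] /andP[? ?].
by rewrite ler_norml; apply/andP; split; lra.
Qed.

Lemma coarse_embedding_dim (R : archiRealFieldType) (T : finType) (n : nat)
    (K d l : R) : 0 <= K -> 0 < d -> 0 < l ->
  (forall e, 0 < e -> exists t : ('I_n -> R) -> T -> R,
     (forall v, cube d v -> cube l (t v)) /\
     (forall v v' h, cube d v -> cube d v' -> 0 <= h -> cube h (t v - t v') ->
        cube (K * h + e) (v - v'))) ->
  (n <= #|T|)%N.
Proof.
move=> K0 d0 l0 emb; rewrite leqNgt; apply/negP => Tn.
pose k := (Num.truncn (4 * l * (K + 1) / d)).+1; pose m := (k ^ #|T|).+1.
have m0 : 0 < m%:R :> R by rewrite ltr0n.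
have K1 : 0 < K + 1 by rewrite ltr_wpDl.
pose h := d / (2 * m%:R * (K + 1)).
have h0 : 0 < h by rewrite divr_gt0 // !mulr_gt0.
have e0 : 0 < d / (2 * m%:R) by rewrite divr_gt0 // mulr_gt0.
have [t [tl tinv]] := emb _ e0.
pose v (g : {ffun 'I_n -> 'I_m}) (j : 'I_n) : R := d / m%:R * (val (g j))%:R.
have vd g : cube d (v g).
  move=> j; rewrite /v ger0_norm ?mulr_ge0 ?divr_ge0 ?(ltW d0) //.
  rewrite mulrAC ler_pdivrMr // ler_pM2l // ler_nat; exact: ltnW (ltn_ord _).
have lh : 2 * l < (k * m)%:R * h.
  have : 4 * l * (K + 1) / d < k%:R by exact: truncnS_gt.
  rewrite ltr_pdivrMr // => lk; rewrite -(ltr_pM2r (mulr_gt0 (ltr0n R 2) K1)).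
  have -> : (k * m)%:R * h * (2 * (K + 1)) = k%:R * d.
    by rewrite natrM /h; field; rewrite !gt_eqF.
  by apply: le_lt_trans lk; rewrite le_eqVlt; apply/orP; left; apply/eqP; ring.
have [g [g' [neq close]]] :=
  grid_pigeonhole h0 lh Tn (ltnSn _) (fun g => tl _ (vd g)).
have [j gj] : exists j, g j != g' j.
  apply/existsP; apply: contraR neq => /existsPn eq_g.
  by apply/eqP/ffunP => j; apply/eqP; rewrite -[_ == _]negbK eq_g.
have := tinv _ _ _ (vd g) (vd g') (ltW h0) close j; apply/negP; rewrite -ltNge.
have gap : d / m%:R <= `|(v g - v g') j|.
  have -> : (v g - v g') j = d / m%:R * ((g j)%:R - (g' j)%:R).
    by rewrite mulrBr.
  rewrite normrM gtr0_norm ?divr_gt0 // ler_pMr ?divr_gt0 //.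
  rewrite -[(g j)%:R]/((val (g j))%:Z%:~R) -[(g' j)%:R]/((val (g' j))%:Z%:~R).
  by rewrite -intrB -intr_norm ler1z -gtz0_ge1 normr_gt0 subr_eq0.
apply: lt_le_trans gap.
have -> : d / m%:R = d / (2 * m%:R) + d / (2 * m%:R) by field; rewrite gt_eqF.
have -> : K * h = d / (2 * m%:R) * (K / (K + 1)).
  by rewrite /h; field; rewrite !gt_eqF.
by rewrite ltrD2r gtr_pMr // ltr_pdivrMr // mul1r ltrDl.
Qed.

(** * Overdetermined systems *)

Definition rat_basis (F : fieldType) (n j : nat) (x : F) : F :=
  x ^+ j / (1 + x ^+ 2) ^+ n.

Definition rat_sum (F : fieldType) (n : nat) (v : 'I_n -> F) (x : F) : F :=
  \sum_(j < n) v j * rat_basis n j x.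

Lemma rat_sumB (F : fieldType) (n : nat) (v w : 'I_n -> F) (x : F) :
  rat_sum (v - w) x = rat_sum v x - rat_sum w x.
Proof. by rewrite /rat_sum -sumrB; apply: eq_bigr => j _; rewrite -mulrBl. Qed.

Lemma rat_sum_poly (F : fieldType) (n : nat) (v : 'I_n -> F) (x : F) :
  1 + x ^+ 2 != 0 ->
  (rVpoly (\row_j v j)).[x] = rat_sum v x * (1 + x ^+ 2) ^+ n.
Proof.
move=> x_neq0; rewrite (horner_coef_wide _ (size_poly _ _)) mulr_suml.
by apply: eq_bigr => j _; rewrite coef_rVpoly_ord mxE mulrA divfK // expf_neq0.
Qed.

Lemma rat_sum_coefs_bound (R : realFieldType) (Q : finType) (A l : R) :
  0 <= A -> 0 < l ->
  exists2 C, 0 <= C & forall (a : Q -> R) (v : 'I_#|Q| -> R) (e : R),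
    cube A a -> separated l a -> cube e (fun q => rat_sum v (a q)) ->
    cube (C * e) v.
Proof.
move=> A0 l0; have sq_gt0 x : 0 < 1 + x ^+ 2 :> R by rewrite ltr_pwDl ?sqr_ge0.
exists (#|Q|%:R * (l^-1 * (1 + A)) ^+ #|Q|.-1 * (1 + A ^+ 2) ^+ #|Q|).
  by rewrite !mulr_ge0 ?exprn_ge0 ?mulr_ge0 ?addr_ge0 ?sqr_ge0 ?invr_ge0 // ltW.
move=> a v e aA sep ve j.
have <- : (rVpoly (\row_j v j))`_j = v j by rewrite coef_rVpoly_ord mxE.
rewrite -[leRHS]mulrA.
apply: (interpolation_bound _ A0 l0 aA sep); first exact: size_poly.
move=> q; rewrite rat_sum_poly ?gt_eqF // normrM mulrC ler_pM //.
rewrite ger0_norm ?exprn_ge0 ?(ltW (sq_gt0 _)) //.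
rewrite lerXn2r ?nnegrE ?(ltW (sq_gt0 _)) // lerD2l -real_normK ?num_real //.
by rewrite lerXn2r ?nnegrE.
Qed.

Lemma klipschitzP (K : numFieldType) (V W : normedModType K) (k : K)
    (f : V -> W) :
  k.-lipschitz f <-> forall x y, `|f x - f y| <= k * `|x - y|.
Proof. by split=> [fL x y|fL [x y] _]; [exact: (fL (x, y))|exact: fL]. Qed.

Lemma klipschitzD (K : numFieldType) (V W : normedModType K) (k l : K)
    (f g : V -> W) :
  k.-lipschitz f -> l.-lipschitz g -> (k + l).-lipschitz (f \+ g).
Proof.
move=> /klipschitzP fL /klipschitzP gL; apply/klipschitzP => x y /=.
by rewrite opprD addrACA (le_trans (ler_normD _ _)) // mulrDl lerD.
Qed.

Lemma klipschitz_continuous (K : realFieldType) (V W : normedModType K) (k : K)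
    (f : V -> W) : k.-lipschitz f -> continuous f.
Proof.
move=> /klipschitzP fL x; apply/cvgrPdist_lt => e e0.
have k0 : 0 < `|k| + 1 by rewrite ltr_wpDl.
near=> y; rewrite (le_lt_trans (fL x y)) //.
apply: (@le_lt_trans _ _ ((`|k| + 1) * `|x - y|)).
  by rewrite ler_wpM2r // (le_trans (ler_norm _)) // lerDl.
rewrite mulrC -ltr_pdivlMr //; near: y.
by apply: cvgr_dist_lt; [exact: cvg_id|exact: divr_gt0].
Unshelve. all: by end_near. Qed.

Lemma klipschitz_rat_sum (R : realType) (n : nat) (d k : R) (v : 'I_n -> R) :
  cube d v -> (forall j : 'I_n, k.-lipschitz (@rat_basis R n j)) ->
  (n%:R * (d * k)).-lipschitz (rat_sum v : R -> R).
Proof.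
move=> vd basisL; apply/klipschitzP => x y; rewrite /rat_sum -sumrB.
rewrite (le_trans (ler_norm_sum _ _ _)) // -mulrA mulr_natl.
rewrite -[n in leRHS]card_ord -sumr_const; apply: ler_sum => j _.
rewrite -mulrBr normrM -mulrA.
by rewrite ler_pM ?vd //; have /klipschitzP := basisL j; apply.
Qed.

Lemma finite_family_bound (R : numDomainType) (Q : finType)
    (P : Q -> R -> Prop) :
  (forall q k k', k <= k' -> P q k -> P q k') ->
  (forall q, exists2 k, 0 <= k & P q k) ->
  exists2 k, 0 <= k & forall q, P q k.
Proof.
move=> Pmono Pex; have /choice[k Pk] q : exists k, 0 <= k /\ P q k.
  by have [k k0 Pk] := Pex q; exists k.
exists (\sum_q k q) => [|q]; first by rewrite sumr_ge0 // => q _; case: (Pk q).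
have [_] := Pk q; apply: Pmono; rewrite (bigD1 q) //= lerDl sumr_ge0 // => i _.
by case: (Pk i).
Qed.

Definition lipschitz_on_cubes (R : numDomainType) (T : Type)
    (g : (T -> R) -> R) : Prop :=
  forall l, 0 <= l -> exists2 k, 0 <= k & forall t t' h,
    cube l t -> cube l t' -> 0 <= h -> cube h (t - t') ->
      `|g t - g t'| <= k * h.

Section LipschitzOnCubes.
Context (R : numDomainType) (T : Type).
Implicit Types g : (T -> R) -> R.

Lemma lipschitz_on_cubes_bounded g l : lipschitz_on_cubes g -> 0 <= l ->
  exists2 B, 0 <= B & forall t, cube l t -> `|g t| <= B.
Proof.
move=> gL l0; have [k k0 g_lip] := gL l l0.
exists (`|g 0| + k * l) => [|t tl]; first by rewrite addr_ge0 ?mulr_ge0.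
rewrite -(subrKC (g 0) (g t)) (le_trans (ler_normD _ _)) // lerD2l.
by apply: g_lip => //; [move=> i; rewrite normr0|rewrite subr0].
Qed.

Lemma lipschitz_on_cubes_cst (c : R) : lipschitz_on_cubes (fun _ : T -> R => c).
Proof. by move=> l l0; exists 0 => // *; rewrite subrr normr0 mul0r. Qed.

Lemma lipschitz_on_cubes_coord (i : T) :
  lipschitz_on_cubes (fun t : T -> R => t i).
Proof. by move=> l l0; exists 1 => // t t' h _ _ _ /(_ i); rewrite mul1r. Qed.

Lemma lipschitz_on_cubesD g1 g2 :
  lipschitz_on_cubes g1 -> lipschitz_on_cubes g2 ->
  lipschitz_on_cubes (fun t => g1 t + g2 t).
Proof.
move=> g1L g2L l l0.
have [k1 k10 {}g1L] := g1L l l0; have [k2 k20 {}g2L] := g2L l l0.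
exists (k1 + k2) => [|t t' h tl t'l h0 tt']; first exact: addr_ge0.
rewrite opprD addrACA (le_trans (ler_normD _ _)) // mulrDl.
by rewrite lerD ?g1L ?g2L.
Qed.

Lemma lipschitz_on_cubesM g1 g2 :
  lipschitz_on_cubes g1 -> lipschitz_on_cubes g2 ->
  lipschitz_on_cubes (fun t => g1 t * g2 t).
Proof.
move=> g1L g2L l l0; have [B1 B10 g1B] := lipschitz_on_cubes_bounded g1L l0.
have [B2 B20 g2B] := lipschitz_on_cubes_bounded g2L l0.
have [k1 k10 {}g1L] := g1L l l0; have [k2 k20 {}g2L] := g2L l l0.
exists (k1 * B2 + B1 * k2) => [|t t' h tl t'l h0 tt'].
  by rewrite addr_ge0 ?mulr_ge0.
have -> : g1 t * g2 t - g1 t' * g2 t' =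
    (g1 t - g1 t') * g2 t' + g1 t * (g2 t - g2 t') by ring.
rewrite (le_trans (ler_normD _ _)) // !normrM mulrDl mulrAC -[B1 * k2 * h]mulrA.
by rewrite lerD // ler_pM ?g1L ?g2L ?g1B ?g2B.
Qed.

Lemma lipschitz_on_cubes_sum (I : Type) (r : seq I) (G : I -> (T -> R) -> R) :
  (forall i, lipschitz_on_cubes (G i)) ->
  lipschitz_on_cubes (fun t => \sum_(i <- r) G i t).
Proof.
move=> GL; elim: r => [|i r IH].
  by under eq_fun do rewrite big_nil; exact: lipschitz_on_cubes_cst.
by under eq_fun do rewrite big_cons; exact: lipschitz_on_cubesD.
Qed.

Lemma lipschitz_on_cubes_family (Q : finType) (G : (T -> R) -> Q -> R) l :
  (forall q, lipschitz_on_cubes (G^~ q)) -> 0 <= l ->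
  exists2 k, 0 <= k & forall t t' h,
    cube l t -> cube l t' -> 0 <= h -> cube h (t - t') ->
      cube (k * h) (G t - G t').
Proof.
move=> GL l0; have [q k k' kk' G_lip t t' h tl t'l h0 tt'||k k0 G_lip] :=
  @finite_family_bound R Q (fun q k => forall t t' h,
    cube l t -> cube l t' -> 0 <= h -> cube h (t - t') ->
      `|G t q - G t' q| <= k * h).
- by rewrite (le_trans (G_lip t t' h tl t'l h0 tt')) // ler_wpM2r.
- by move=> q; exact: GL.
- by exists k => // t t' h tl t'l h0 tt' q; exact: G_lip.
Qed.

Lemma lipschitz_on_cubes_family_bounded (Q : finType)
    (G : (T -> R) -> Q -> R) l :
  (forall q, lipschitz_on_cubes (G^~ q)) -> 0 <= l ->
  exists2 B, 0 <= B & forall t, cube l t -> cube B (G t).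
Proof.
move=> GL l0; have [q k k' kk' G_bound_k t tl||B B0 G_bound] :=
  @finite_family_bound R Q (fun q B => forall t, cube l t -> `|G t q| <= B).
- exact: le_trans (G_bound_k t tl) kk'.
- by move=> q; exact: lipschitz_on_cubes_bounded (GL q) l0.
- by exists B => // t tl q; exact: G_bound.
Qed.

End LipschitzOnCubes.

(* The equations [value t q = f (argument t q)], for an unknown parameter vector
   [t]; only the [t] with pairwise distinct arguments count as solutions. *)
Record system (R : realType) := System {
  unknown : finType;
  equation : finType;
  argument : (unknown -> R) -> equation -> R;
  value : (unknown -> R) -> equation -> R;
  overdetermined : (#|unknown| < #|equation|)%N;
  argument_lipschitz : forall q, lipschitz_on_cubes (argument^~ q);
  value_lipschitz : forall q, lipschitz_on_cubes (value^~ q)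
}.

Section Systems.
Context (R : realType).
Implicit Types (P : system R) (f g : R -> R) (l d e : R).

Definition residual P f (t : unknown P -> R) (q : equation P) : R :=
  value t q - f (argument t q).

Definition avoids f P : Prop :=
  forall t : unknown P -> R, injective (argument t) ->
    exists q, residual f t q != 0.

Definition robustly_avoids f P l e : Prop :=
  forall t : unknown P -> R, cube l t -> separated l^-1 (argument t) ->
    ~ cube e (residual f t).

Lemma robustly_avoids_perturb f g P l e : robustly_avoids f P l e ->
  (forall x, `|f x - g x| <= e) -> robustly_avoids g P l 0.
Proof.
move=> favoid fg t tl sep g0; apply: (favoid t tl sep) => q.
have := g0 q; rewrite /residual normr_le0 subr_eq0 => /eqP ->.
by rewrite distrC fg.
Qed.

Lemma robustly_avoids_avoids f P :
  (forall n, robustly_avoids f P n.+1%:R 0) -> avoids f P.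
Proof.
move=> favoid t arg_inj; pose a := argument t.
pose s := \sum_i `|t i| + \sum_p `|a p.1 - a p.2|^-1.
have s_lt : s < (Num.truncn s).+1%:R by exact: truncnS_gt.
apply: contrapT => /forallNP res0; apply: (favoid (Num.truncn s) t).
- move=> i; rewrite (le_trans _ (ltW s_lt)) // /s (bigD1 i) //= -addrA lerDl.
  by rewrite addr_ge0 ?sumr_ge0 // => p _; rewrite invr_ge0.
- move=> q q' neq; have dist_gt0 : 0 < `|a q - a q'|.
    by rewrite normr_gt0 subr_eq0 (inj_eq arg_inj).
  rewrite -[leRHS]invrK lef_pV2 ?posrE ?invr_gt0 //.
  rewrite (le_trans _ (ltW s_lt)) // /s (bigD1 (q, q')) //= addrCA lerDl.
  by rewrite addr_ge0 ?sumr_ge0 // => p _; rewrite invr_ge0.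
by move=> q; have /negP := res0 q; rewrite negbK => /eqP ->; rewrite normr0.
Qed.

Lemma near_solutions_determine_coefs P f kf kb l d :
  0 < l -> 0 <= d -> 0 <= kf -> 0 <= kb -> kf.-lipschitz f ->
  (forall j : 'I_#|equation P|, kb.-lipschitz (@rat_basis R #|equation P| j)) ->
  exists K C, [/\ 0 <= K, 0 <= C &
    forall (v v' : 'I_#|equation P| -> R) (t t' : unknown P -> R) h e,
      cube d v' -> cube l t -> cube l t' -> separated l^-1 (argument t) ->
      cube e (residual (f \+ rat_sum v) t) ->
      cube e (residual (f \+ rat_sum v') t') ->
      0 <= h -> cube h (t - t') -> cube (K * h + C * e) (v - v')].
Proof.
move=> l0 d0 kf0 kb0 fL basisL; set n := #|equation P|.
have [ka ka0 argL] :=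
  lipschitz_on_cubes_family (@argument_lipschitz _ P) (ltW l0).
have [kv kv0 valL] := lipschitz_on_cubes_family (@value_lipschitz _ P) (ltW l0).
have [B B0 argB] :=
  lipschitz_on_cubes_family_bounded (@argument_lipschitz _ P) (ltW l0).
have il0 : 0 < l^-1 by rewrite invr_gt0.
have [C C0 coefs] := rat_sum_coefs_bound (equation P) B0 il0.
pose ks := kf + n%:R * (d * kb).
have ks0 : 0 <= ks by rewrite addr_ge0 // !mulr_ge0.
exists (C * (kv + ks * ka)), (C * 2); split=> [||v v' t t' h e v'd tl t'l sep].
- by rewrite !(mulr_ge0, addr_ge0).
- by rewrite mulr_ge0.
move=> res_t res_t' h0 tt'; rewrite -!mulrA -mulrDr.
apply: (coefs _ _ _ (argB t tl) sep) => q; rewrite rat_sumB.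
have /klipschitzP sL := klipschitzD fL (klipschitz_rat_sum v'd basisL).
set a := argument t q; set a' := argument t' q.
have -> : rat_sum v a - rat_sum v' a =
    residual (f \+ rat_sum v') t' q - residual (f \+ rat_sum v) t q
    + (value t q - value t' q) - ((f \+ rat_sum v') a - (f \+ rat_sum v') a').
  by rewrite /residual /= -/a -/a'; ring.
have -> : (kv + ks * ka) * h + 2 * e = e + e + kv * h + ks * (ka * h) by ring.
rewrite (le_trans (ler_normB _ _)) // lerD //; last first.
  by rewrite (le_trans (sL _ _)) // ler_wpM2l // (argL t t' h).
rewrite (le_trans (ler_normD _ _)) // lerD //; last exact: (valL t t' h).
by rewrite (le_trans (ler_normB _ _)) // lerD.
Qed.

Lemma robust_perturbation P f kf kb l d :
  0 < l -> 0 < d -> 0 <= kf -> 0 <= kb -> kf.-lipschitz f ->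
  (forall j : 'I_#|equation P|, kb.-lipschitz (@rat_basis R #|equation P| j)) ->
  exists2 v : 'I_#|equation P| -> R, cube d v &
    exists2 e, 0 < e & robustly_avoids (f \+ rat_sum v) P l e.
Proof.
move=> l0 d0 kf0 kb0 fL basisL; set n := #|equation P|.
have [K [C [K0 C0 coefs]]] :=
  near_solutions_determine_coefs l0 (ltW d0) kf0 kb0 fL basisL.
apply: contrapT => no_v; suff : (n <= #|unknown P|)%N.
  by rewrite leqNgt overdetermined.
apply: (coarse_embedding_dim K0 d0 l0) => e e0.
have C1 : 0 < C + 1 by rewrite ltr_wpDl.
pose e' := e / (C + 1); have e'0 : 0 < e' by rewrite divr_gt0.
have /choice[t near_solution] (v : 'I_n -> R) : exists t : unknown P -> R,
    cube d v -> [/\ cube l t, separated l^-1 (argument t) &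
        cube e' (residual (f \+ rat_sum v) t)].
  have [vd|] := pselect (cube d v); last by exists 0.
  apply: contrapT => /forallNP no_t; apply: no_v; exists v => //.
  by exists e' => // t tl sep res; apply: (no_t t) => _.
exists t; split=> [v /near_solution[]//|v v' h vd v'd h0 tt' j].
have [tl sep res] := near_solution v vd.
have [t'l _ res'] := near_solution v' v'd.
apply: le_trans (coefs v v' _ _ h e' v'd tl t'l sep res res' h0 tt' j) _.
by rewrite lerD2l /e' mulrCA ler_piMr ?(ltW e0) // ler_pdivrMr // mul1r lerDl.
Qed.

End Systems.

(** * Completeness of the complex plane *)

Section ComplexNorm.
Context (R : realType).
Implicit Types (x : R) (z w : R[i]).

Lemma normc_real x : `|x%:C| = (`|x|)%:C.
Proof. by rewrite normc_def /= expr0n addr0 sqrtr_sqr. Qed.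

Lemma normc_ge_Im z : (`|complex.Im z|)%:C <= `|z|.
Proof.
have := normc_ge_Re (z * 'i); rewrite ReiNIm normrN => /le_trans; apply.
by rewrite normrM [X in _ * X]normc_def /= expr0n expr1n add0r sqrtr1 mulr1.
Qed.

Lemma normc_le_ReIm z : `|z| <= (`|complex.Re z| + `|complex.Im z|)%:C.
Proof.
rewrite {1}(complexE z) (le_trans (ler_normD _ _)) // rmorphD.
rewrite lerD ?normc_real // normrM normc_real [X in X * _]normc_def /=.
by rewrite expr0n expr1n add0r sqrtr1 mul1r.
Qed.

Lemma ReB z w : complex.Re (z - w) = complex.Re z - complex.Re w.
Proof. by case: z w => ? ? []. Qed.

Lemma ImB z w : complex.Im (z - w) = complex.Im z - complex.Im w.
Proof. by case: z w => ? ? []. Qed.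

Lemma gt0_complexE z : 0 < z -> z = (complex.Re z)%:C.
Proof. by move=> z0; rewrite RRe_real // gtr0_real. Qed.

End ComplexNorm.

Lemma complex_cauchy_cvg (R : realType) (F : set_system R[i]^o)
    {FF : ProperFilter F} :
  cauchy F -> cvg F.
Proof.
move=> /cauchy_ballP FC.
have part_cvg (p : R[i]^o -> R) :
    (forall z w, (`|p z - p w|)%:C <= `|z - w|) -> cvg (p @ F).
  move=> p_le; apply: cauchy_cvg; apply: cauchy_exP => e e0.
  have e0C : 0 < e%:C by rewrite ltcR.
  have [[A B] /= [FA FB] AB] := FC _ e0C; have [z Az] := filter_ex FA.
  exists (p z); apply: filterS FB => w Bw; rewrite /ball /= -ltcR.
  exact: le_lt_trans (p_le z w) (AB (z, w) (conj Az Bw)).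
have /cvg_ex[a Fa] : cvg ((@complex.Re R : R[i]^o -> R) @ F).
  by apply: part_cvg => z w; rewrite -ReB; exact: normc_ge_Re.
have /cvg_ex[b Fb] : cvg ((@complex.Im R : R[i]^o -> R) @ F).
  by apply: part_cvg => z w; rewrite -ImB; exact: normc_ge_Im.
apply/cvg_ex; exists (a +i* b); apply/cvgrPdist_lt => e e0.
have re0 : 0 < complex.Re e / 2 by rewrite divr_gt0 // -ltcR -gt0_complexE.
near=> z; rewrite (le_lt_trans (normc_le_ReIm _)) // [ltRHS]gt0_complexE //.
rewrite ltcR ReB ImB [ltRHS]splitr ltrD //=; near: z.
- by move/cvgrPdist_lt : Fa; apply.
- by move/cvgrPdist_lt : Fb; apply.
Unshelve. all: by end_near. Qed.

(** * Functions with bounded divided differences *)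

(* Bounds [f] and its first two divided differences on [S], the second one with
   the denominators cleared; on an open set of complex numbers this makes [f]
   holomorphic. Unlike differentiability it is closed under pointwise limits. *)
Definition C11_bound (K : numFieldType) (S : set K) (M : K)
    (f : K -> K) : Prop :=
  forall x y z, S x -> S y -> S z ->
    [/\ `|f x| <= M, `|f x - f y| <= M * `|x - y| &
        `|(f x - f y) * (x - z) - (f x - f z) * (x - y)| <=
          M * `|x - y| * `|x - z| * `|y - z|].

Lemma norm_cvg_le (K : numFieldType) (V : normedModType K) (u : nat -> V)
    (l : V) (M : K) : u @ \oo --> l -> (forall n, `|u n| <= M) -> `|l| <= M.
Proof.
move=> /cvgrPdist_le ul uM; apply/ler_addgt0Pr => e /ul le; near \oo => n.
rewrite -(subrK (u n) l) (le_trans (ler_normD _ _)) // addrC lerD //.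
by near: n.
Unshelve. all: by end_near. Qed.

Section C11Theory.
Context (K : numFieldType) (S : set K).
Implicit Types (M c : K) (f g : K -> K).

Lemma C11_bound_ext M f g : (forall z, S z -> f z = g z) ->
  C11_bound S M f -> C11_bound S M g.
Proof. by move=> fg fC x y z Sx Sy Sz; rewrite -!fg //; exact: fC. Qed.

Lemma C11_bound_le M M' f : M <= M' -> C11_bound S M f -> C11_bound S M' f.
Proof.
move=> MM' fC x y z Sx Sy Sz; have [f0 f1 f2] := fC x y z Sx Sy Sz; split.
- exact: le_trans MM'.
- by rewrite (le_trans f1) // ler_wpM2r.
- by rewrite (le_trans f2) // !ler_wpM2r.
Qed.

Lemma C11_bound_cst c : C11_bound S `|c| (fun=> c).
Proof.
by move=> x y z *; split; rewrite // ?subrr ?mul0r ?subrr normr0 !mulr_ge0.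
Qed.

Lemma C11_bound0 : C11_bound S 0 (fun=> 0).
Proof. by have := C11_bound_cst 0; rewrite normr0. Qed.

Lemma C11_boundD M1 M2 f g : C11_bound S M1 f -> C11_bound S M2 g ->
  C11_bound S (M1 + M2) (fun z => f z + g z).
Proof.
move=> fC gC x y z Sx Sy Sz; have [f0 f1 f2] := fC x y z Sx Sy Sz.
have [g0 g1 g2] := gC x y z Sx Sy Sz; split.
- by rewrite (le_trans (ler_normD _ _)) // lerD.
- by rewrite opprD addrACA (le_trans (ler_normD _ _)) // mulrDl lerD.
have -> :
    (f x + g x - (f y + g y)) * (x - z) - (f x + g x - (f z + g z)) * (x - y) =
    (f x - f y) * (x - z) - (f x - f z) * (x - y) +
    ((g x - g y) * (x - z) - (g x - g z) * (x - y)) by ring.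
by rewrite (le_trans (ler_normD _ _)) // 3![in leRHS]mulrDl lerD.
Qed.

Lemma C11_boundZ c M f : C11_bound S M f ->
  C11_bound S (`|c| * M) (fun z => c * f z).
Proof.
move=> fC x y z Sx Sy Sz; have [f0 f1 f2] := fC x y z Sx Sy Sz; split.
- by rewrite normrM ler_wpM2l.
- by rewrite -mulrBr normrM -mulrA ler_wpM2l.
by rewrite -!mulrBr -!(mulrA c) -mulrBr normrM -!mulrA ler_wpM2l // !mulrA.
Qed.

Lemma C11_bound_sum (I : Type) (r : seq I) (M : I -> K) (f : I -> K -> K) :
  (forall i, C11_bound S (M i) (f i)) ->
  C11_bound S (\sum_(i <- r) M i) (fun z => \sum_(i <- r) f i z).
Proof.
move=> fC; elim: r => [|i r IH].
  by rewrite big_nil; apply: C11_bound_ext C11_bound0 => z _; rewrite big_nil.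
rewrite big_cons; apply: C11_bound_ext (C11_boundD (fC i) IH) => z _.
by rewrite big_cons.
Qed.

Lemma C11_boundM M1 M2 f g : C11_bound S M1 f -> C11_bound S M2 g ->
  C11_bound S (3 * (M1 * M2)) (fun z => f z * g z).
Proof.
move=> fC gC x y z Sx Sy Sz.
have [f0x f1 f2] := fC x y z Sx Sy Sz; have [f0y f1yz _] := fC y z z Sy Sz Sz.
have [g0x g1 g2] := gC x y z Sx Sy Sz; have [_ g1xz _] := gC x z z Sx Sz Sz.
have M10 : 0 <= M1 by exact: le_trans f0x.
have M20 : 0 <= M2 by exact: le_trans g0x.
have M120 : 0 <= M1 * M2 by rewrite mulr_ge0.
split.
- by rewrite normrM (le_trans (ler_pM _ _ f0x g0x)) // ler_peMl // ler1n.
- have -> : f x * g x - f y * g y =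
      (f x - f y) * g x + f y * (g x - g y) by ring.
  have -> : 3 * (M1 * M2) * `|x - y| =
      M1 * `|x - y| * M2 + M1 * (M2 * `|x - y|) + M1 * M2 * `|x - y| by ring.
  rewrite ler_wpDr ?mulr_ge0 // (le_trans (ler_normD _ _)) // !normrM.
  by rewrite lerD // ler_pM.
have -> :
    (f x * g x - f y * g y) * (x - z) - (f x * g x - f z * g z) * (x - y) =
    f y * ((g x - g y) * (x - z) - (g x - g z) * (x - y)) +
    g x * ((f x - f y) * (x - z) - (f x - f z) * (x - y)) +
    (g x - g z) * ((x - y) * (f y - f z)) by ring.
have -> : 3 * (M1 * M2) * `|x - y| * `|x - z| * `|y - z| =
    M1 * (M2 * `|x - y| * `|x - z| * `|y - z|) +
    M2 * (M1 * `|x - y| * `|x - z| * `|y - z|) +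
    M2 * `|x - z| * (`|x - y| * (M1 * `|y - z|)) by ring.
rewrite (le_trans (ler_normD _ _)) // lerD //.
  by rewrite (le_trans (ler_normD _ _)) // !normrM lerD // ler_pM // ?normr_ge0.
by rewrite normrM (normrM (x - y)) ler_pM ?mulr_ge0 // ler_wpM2l.
Qed.

(* The divided differences of [(z - a)^-1] are products of its values. *)
Lemma C11_boundV a d : 0 < d -> (forall z, S z -> d <= `|z - a|) ->
  C11_bound S (d^-1 + d^-1 ^+ 2 + d^-1 ^+ 3) (fun z => (z - a)^-1).
Proof.
move=> d0 Sd x y z Sx Sy Sz; have i0 : 0 <= d^-1 by rewrite invr_ge0 ltW.
have neq0 w : S w -> w - a != 0.
  by move=> /Sd dw; rewrite -normr_gt0 (lt_le_trans d0).
have inv_le w : S w -> `|(w - a)^-1| <= d^-1.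
  by move=> Sw; rewrite normfV lef_pV2 ?posrE ?Sd // normr_gt0 neq0.
split.
- by rewrite (le_trans (inv_le x Sx)) // -addrA lerDl addr_ge0 ?exprn_ge0.
- have -> : (x - a)^-1 - (y - a)^-1 = - ((x - a)^-1 * (y - a)^-1) * (x - y).
    by field; rewrite !neq0.
  rewrite normrM normrN normrM ler_wpM2r // (@le_trans _ _ (d^-1 ^+ 2)) //.
    by rewrite expr2 ler_pM ?inv_le.
  by rewrite addrAC lerDr addr_ge0 ?exprn_ge0.
have -> :
    ((x - a)^-1 - (y - a)^-1) * (x - z) - ((x - a)^-1 - (z - a)^-1) * (x - y) =
    (x - a)^-1 * (y - a)^-1 * (z - a)^-1 * (x - y) * (x - z) * (y - z).
  by field; rewrite !neq0.
rewrite !(normrM _ (_ - _)) !ler_wpM2r // (@le_trans _ _ (d^-1 ^+ 3)) //.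
  by rewrite !normrM !exprS expr0 mulr1 mulrA !ler_pM ?mulr_ge0 ?inv_le.
by rewrite lerDr addr_ge0 ?exprn_ge0.
Qed.

Lemma C11_bound_cvg M (f : nat -> K -> K) (g : K^o -> K^o) :
  (forall n, C11_bound S M (f n)) ->
  (forall z, S z -> (f n z : K^o) @[n --> \oo] --> g z) -> C11_bound S M g.
Proof.
move=> fC fg x y z Sx Sy Sz; split.
- by apply: norm_cvg_le (fg x Sx) _ => n; case: (fC n x y z Sx Sy Sz).
- apply: norm_cvg_le (cvgB (fg x Sx) (fg y Sy)) _ => n.
  by case: (fC n x y z Sx Sy Sz).
apply: (@norm_cvg_le K K^o (fun n => (f n x - f n y) * (x - z) -
    (f n x - f n z) * (x - y))) => [|n]; last by case: (fC n x y z Sx Sy Sz).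
by apply: cvgB; apply: cvgMl; apply: cvgB; exact: fg.
Qed.

Definition C11_on f : Prop := exists M, C11_bound S M f.

Lemma C11_on_ext f g : (forall z, S z -> f z = g z) -> C11_on f -> C11_on g.
Proof. by move=> fg [M fC]; exists M; exact: C11_bound_ext fC. Qed.

Lemma C11_onD f g : C11_on f -> C11_on g -> C11_on (fun z => f z + g z).
Proof. by move=> [M1 fC] [M2 gC]; exists (M1 + M2); exact: C11_boundD. Qed.

Lemma C11_onZ c f : C11_on f -> C11_on (fun z => c * f z).
Proof. by move=> [M fC]; exists (`|c| * M); exact: C11_boundZ. Qed.

Lemma C11_onM f g : C11_on f -> C11_on g -> C11_on (fun z => f z * g z).
Proof.
by move=> [M1 fC] [M2 gC]; exists (3 * (M1 * M2)); exact: C11_boundM.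
Qed.

Lemma C11_onX f n : C11_on f -> C11_on (fun z => f z ^+ n).
Proof.
move=> fC; elim: n => [|n IH]; first by exists `|1|; exact: C11_bound_cst.
by under eq_fun do rewrite exprS; exact: C11_onM.
Qed.

End C11Theory.

Lemma C11_bound_derivable (R : realType) (S : set R[i]^o) (M : R[i])
    (f : R[i]^o -> R[i]^o) (z : R[i]^o) :
  open S -> C11_bound S M f -> S z -> derivable f z 1.
Proof.
move=> oS fC Sz; apply: complex_cauchy_cvg; apply: cauchy_exP => e e0.
have M0 : 0 <= M by have [f0 _ _] := fC z z z Sz Sz Sz; exact: le_trans f0.
have M1 : 0 < M + 1 by rewrite ltr_wpDl.
have [r r0 Sr] : exists2 r : R[i], 0 < r & forall h, `|h| < r -> S (h + z).
  have /nbhs_ballP[r /= r0 Sr] : nbhs z S by exact: open_nbhs_nbhs.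
  exists r => // h hr; apply: Sr.
  by rewrite /ball /= opprD addrCA subrr addr0 normrN.
have d0 : 0 < e / (M + 1) / 2 by rewrite !divr_gt0.
have small : \forall h \near (0 : R[i]^o)^',
    [/\ h != 0, S (h + z) & `|h| < e / (M + 1) / 2].
  near=> h; split.
  - by near: h; exact: nbhs_dnbhs_neq.
  - by apply: Sr; near: h; exact: dnbhs0_lt.
  - by near: h; exact: dnbhs0_lt.
have [h [h0 Sh hd]] :=
  @filter_ex _ _ (Proper_dnbhs_regular_numFieldType (0 : R[i]^o)) _ small.
exists (h^-1 *: (f (h *: 1 + z) - f z)); apply: filterS small => k [k0 Sk kd].
rewrite /ball /= ![_ *: 1]mulr1 /GRing.scale /=.
have [_ _] := fC z (h + z) (k + z) Sz Sh Sk.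
have cancel w : z - (w + z) = - w by rewrite opprD addrCA subrr addr0.
have -> : h + z - (k + z) = h - k by ring.
rewrite !cancel !normrN => fhk.
have -> : h^-1 * (f (h + z) - f z) - k^-1 * (f (k + z) - f z) =
    ((f z - f (h + z)) * - k - (f z - f (k + z)) * - h) / (h * k).
  by field; rewrite h0 k0.
have hk0 : 0 < `|h| * `|k| by rewrite mulr_gt0 ?normr_gt0.
rewrite normrM normfV normrM ltr_pdivrMr // (le_lt_trans fhk) //.
have -> : M * `|h| * `|k| * `|h - k| = M * `|h - k| * (`|h| * `|k|) by ring.
rewrite ltr_pM2r // (@le_lt_trans _ _ ((M + 1) * (`|h| + `|k|))) //.
  by rewrite ler_pM ?ler_normB ?lerDl.
rewrite mulrC -ltr_pdivlMr // [ltRHS]splitr; exact: ltrD.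
Unshelve. all: by end_near. Qed.

(** * Generic perturbations on a strip *)

Definition strip (R : realType) (c : R) : set R[i] :=
  [set z | `|complex.Im z| < c].

Section Strip.
Context (R : realType) (c : R).

Lemma strip_real (x : R) : 0 < c -> strip c x%:C.
Proof. by rewrite /strip /= normr0. Qed.

Lemma strip_open : open (strip c : set R[i]^o).
Proof.
rewrite openE => z zc; apply/nbhs_ballP.
exists (c - `|complex.Im z|)%:C => [|w]; first by rewrite /= ltcR subr_gt0.
rewrite /ball /= => /(le_lt_trans (normc_ge_Im _)); rewrite ltcR ImB ltrBrDl.
by apply: le_lt_trans; rewrite -lerBlDl distrC lerB_dist.
Qed.

Lemma strip_dist_ge (a z : R[i]) : strip c z -> c <= `|complex.Im a| / 2 ->
  c%:C <= `|z - a|.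
Proof.
move=> zc ca; rewrite (le_trans _ (normc_ge_Im _)) // lecR ImB distrC.
rewrite (le_trans _ (lerB_dist _ _)) //; have := ltW zc; lra.
Qed.

Definition on_line (F : R[i] -> R[i]) (x : R) : R := complex.Re (F x%:C).

Definition real_on_line (F : R[i] -> R[i]) : Prop :=
  forall x : R, F x%:C = (on_line F x)%:C.

Lemma C11_bound_on_line (M : R) (F : R[i] -> R[i]) : 0 < c ->
  C11_bound (strip c) M%:C F -> real_on_line F ->
  0 <= M /\ M.-lipschitz (on_line F).
Proof.
move=> c0 FC FR.
have FC' x y := FC _ _ _ (strip_real x c0) (strip_real y c0) (strip_real y c0).
split; first by have [F0 _ _] := FC' 0 0; rewrite -ler0c (le_trans _ F0).
apply/klipschitzP => x y; have [_ + _] := FC' x y.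
by rewrite !FR -!rmorphB /= !normc_real -rmorphM lecR.
Qed.

End Strip.

Lemma C11_on_rat_basis (R : realType) (n j : nat) : (j <= n)%N ->
  C11_on (strip 2^-1) (@rat_basis R[i] n j).
Proof.
move=> jn; pose u (z : R[i]) := (z - 'i)^-1; pose w (z : R[i]) := (z - - 'i)^-1.
have dist_ge (a : R[i]) : `|complex.Im a| = 1 -> forall z, strip 2^-1 z ->
  2^-1%:C <= `|z - a|.
  by move=> a1 z Sz; apply: strip_dist_ge => //; rewrite a1 div1r.
have half0 : 0 < (2^-1 : R)%:C by rewrite ltcR invr_gt0.
have Im_i : `|complex.Im ('i : R[i])| = 1 by rewrite normr1.
have Im_Ni : `|complex.Im (- 'i : R[i])| = 1 by rewrite /= normrN normr1.
have uC : C11_on (strip 2^-1) u.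
  by eexists; exact: C11_boundV half0 (dist_ge _ Im_i).
have wC : C11_on (strip 2^-1) w.
  by eexists; exact: C11_boundV half0 (dist_ge _ Im_Ni).
pose uw z := (2^-1 * (u z + w z)) ^+ j * (u z * w z) ^+ (n - j).
apply: (@C11_on_ext _ _ uw).
  move=> z Sz; rewrite /uw.
  have z1 : z - 'i != 0 by rewrite -normr_gt0 (lt_le_trans half0) ?dist_ge.
  have z2 : z - - 'i != 0 by rewrite -normr_gt0 (lt_le_trans half0) ?dist_ge.
  have sqE : 1 + z ^+ 2 = (z - 'i) * (z - - 'i).
    by rewrite opprK -subr_sqr sqr_i opprK addrC.
  have -> : 2^-1 * (u z + w z) = z / (1 + z ^+ 2).
    by rewrite sqE /u /w; field; rewrite z1 z2.
  rewrite /uw -invfM -sqE /rat_basis expr_div_n exprVn -mulrA -invfM -exprD.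
  by rewrite subnKC.
by apply: C11_onM; apply: C11_onX;
  [apply: C11_onZ; exact: C11_onD|exact: C11_onM].
Qed.

Lemma rat_basis_real (R : realType) (n j : nat) (x : R) :
  rat_basis n j x%:C = (rat_basis n j x)%:C.
Proof. by rewrite /rat_basis fmorph_div !rmorphXn rmorphD rmorph1 rmorphXn. Qed.

Lemma rat_sum_real (R : realType) (n : nat) (v : 'I_n -> R) (x : R) :
  rat_sum (fun j => (v j)%:C) x%:C = (rat_sum v x)%:C.
Proof.
rewrite /rat_sum rmorph_sum; apply: eq_bigr => j _.
by rewrite rmorphM rat_basis_real.
Qed.

Lemma halving_cvg0 (R : realType) (b : nat -> R) : (forall n, 0 <= b n) ->
  (forall n, b n.+1 <= b n / 2) -> b @ \oo --> 0.
Proof.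
move=> b0 bh; apply: (@squeeze_cvgr _ _ _ _ (cst 0) (geometric (b 0%N) 2^-1)).
- apply: nearW => n; rewrite b0 /=.
  elim: n => [|n IH]; first by rewrite expr0 mulr1.
  by rewrite (le_trans (bh n)) // exprSr mulrA ler_wpM2r.
- exact: cvg_cst.
- by apply: cvg_geometric; rewrite gtr0_norm ?invf_lt1 ?ltr1n.
Qed.

Lemma C11_bound_halving_limit (R : realType) (S : set R[i])
    (F : nat -> R[i] -> R[i]) (b : nat -> R) :
  (forall n, 0 <= b n) -> (forall n, b n.+1 <= b n / 2) ->
  (forall n, C11_bound S (b n / 2)%:C (fun z => F n.+1 z - F n z)) ->
  exists G, forall n, C11_bound S (b n)%:C (fun z => G z - F n z).
Proof.
move=> b0 bh FC.
have telescope n k :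
    C11_bound S (b n - b (n + k)%N)%:C (fun z => F (n + k)%N z - F n z).
  elim: k => [|k IH].
    rewrite addn0 subrr rmorph0.
    by apply: (C11_bound_ext _ (@C11_bound0 _ S)) => z _; rewrite subrr.
  apply: (@C11_bound_le _ _ ((b n - b (n + k)%N)%:C + (b (n + k)%N / 2)%:C)).
    by rewrite -rmorphD lecR addnS; have := bh (n + k)%N; lra.
  apply: C11_bound_ext (C11_boundD IH (FC (n + k)%N)) => z _.
  by rewrite addnS; ring.
have tail n k : C11_bound S (b n)%:C (fun z => F (n + k)%N z - F n z).
  by apply: C11_bound_le (telescope n k); rewrite lecR gerBl.
have /choice[G FG] z : exists l : R[i]^o,
    S z -> (F n z : R[i]^o) @[n --> \oo] --> l.
  have [Sz|] := pselect (S z); last by exists 0.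
  suff /cvg_ex[l Fl] : cvg ((F n z : R[i]^o) @[n --> \oo]) by exists l.
  apply: complex_cauchy_cvg; apply: cauchy_exP => e e0.
  have re0 : 0 < complex.Re e by rewrite -ltcR -gt0_complexE.
  have /cvgrPdist_lt/(_ _ re0)[n _ /(_ n (leqnn n)) bn] := halving_cvg0 b0 bh.
  exists (F n z); exists n => // m /= nm; rewrite /ball /= -(subnKC nm) distrC.
  have [Fnm _ _] := tail n (m - n)%N z z z Sz Sz Sz; apply: le_lt_trans Fnm _.
  by move: bn; rewrite sub0r normrN ger0_norm // -ltcR -gt0_complexE.
exists G => n; apply: (@C11_bound_cvg R[i] S (b n)%:C
  (fun k z => F (n + k)%N z - F n z) (fun z => G z - F n z)) => [k|z Sz].
  exact: tail.
apply: cvgB; last exact: cvg_cst.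
by have := FG z Sz; rewrite -(cvg_shiftn n); under eq_fun do rewrite addnC.
Qed.

Section GenericPerturbation.
Context (R : realType).
Local Notation S := (strip 2^-1 : set R[i]).

Let half_gt0 : 0 < 2^-1 :> R.
Proof. by rewrite invr_gt0. Qed.

Lemma C11_bound_rat_basis n : exists2 M : R, 0 <= M &
  forall j : 'I_n, C11_bound S M%:C (@rat_basis R[i] n j).
Proof.
apply: (@finite_family_bound R _
    (fun (j : 'I_n) M => C11_bound S M%:C (@rat_basis R[i] n j))).
  by move=> j M M' MM'; apply: C11_bound_le; rewrite lecR.
move=> j; have [M MC] := @C11_on_rat_basis R n j (ltnW (ltn_ord j)).
have S0 := strip_real 0 half_gt0; have [M0 _ _] := MC _ _ _ S0 S0 S0.
have M_ge0 : 0 <= M by exact: le_trans M0.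
have ME : M = (complex.Re M)%:C by rewrite RRe_real // ger0_real.
by exists (complex.Re M); rewrite -?ler0c -ME.
Qed.

Lemma system_perturbation (f : R -> R) (k : R) (P : system R) (l b : R) :
  0 <= k -> k.-lipschitz f -> 0 < l -> 0 < b ->
  exists G : R[i] -> R[i], [/\ C11_bound S b%:C G, real_on_line G &
    exists2 e, 0 < e & robustly_avoids (f \+ on_line G) P l e].
Proof.
move=> k0 fL l0 b0; set n := #|equation P|.
have [B B0 basisC] := C11_bound_rat_basis n.
have basisL (j : 'I_n) : B.-lipschitz (@rat_basis R n j).
  have [|_] := C11_bound_on_line half_gt0 (basisC j).
    by move=> x; rewrite /on_line rat_basis_real.
  by congr (_.-lipschitz _); apply/funext => x; rewrite /on_line rat_basis_real.
have nB : 0 < n%:R * B + 1 by rewrite ltr_wpDl // mulr_ge0.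
have d0 : 0 < b / (n%:R * B + 1) by rewrite divr_gt0.
have [v vd [e e0 avoid]] := robust_perturbation l0 d0 k0 B0 fL basisL.
have lineE : on_line (rat_sum (fun j => (v j)%:C)) = rat_sum v.
  by apply/funext => x; rewrite /on_line rat_sum_real.
exists (rat_sum (fun j => (v j)%:C)); split.
- have termC (j : 'I_n) := C11_boundZ (v j)%:C (basisC j).
  apply: C11_bound_le (C11_bound_sum (index_enum 'I_n) termC).
  apply: (@le_trans _ _ (\sum_(j < n) (b / (n%:R * B + 1) * B)%:C)).
    by apply: ler_sum => j _; rewrite normc_real -rmorphM lecR ler_wpM2r.
  rewrite -rmorph_sum lecR sumr_const card_ord -[_ *+ n]mulr_natl.
  have -> : n%:R * (b / (n%:R * B + 1) * B) =
    b * (n%:R * B) / (n%:R * B + 1) by ring.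
  by rewrite ler_pdivrMr // ler_pM2l // lerDl.
- by move=> x; rewrite rat_sum_real lineE.
- by exists e => //; rewrite lineE.
Qed.

Lemma perturbation_step (f : R -> R) (k M : R) (P : system R) (l b : R)
    (F : R[i] -> R[i]) :
  k.-lipschitz f -> 0 <= k -> 0 < l -> 0 < b ->
  real_on_line F -> C11_bound S M%:C F ->
  exists (F' : R[i] -> R[i]) (b' : R),
    [/\ 0 < b' <= b / 2, real_on_line F', C11_bound S (M + b / 2)%:C F',
      C11_bound S (b / 2)%:C (fun z => F' z - F z) &
      robustly_avoids (f \+ on_line F') P l b'].
Proof.
move=> fL k0 l0 b0 FR FC; have [M0 FL] := C11_bound_on_line half_gt0 FC FR.
have half_b0 : 0 < b / 2 by rewrite divr_gt0.
have [G [GC GR [e e0 avoid]]] :=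
  system_perturbation P (addr_ge0 k0 M0) (klipschitzD fL FL) l0 half_b0.
have lineD : on_line (fun z => F z + G z) = on_line F \+ on_line G.
  by apply/funext => x; rewrite /on_line FR GR.
exists (fun z => F z + G z), (Num.min (b / 2) e); split.
- by rewrite lt_min half_b0 e0 ge_min lexx.
- by move=> x; rewrite lineD FR GR rmorphD.
- by rewrite rmorphD; exact: C11_boundD FC GC.
- by apply: C11_bound_ext GC => z _; rewrite addrC addKr.
move=> t tl sep res; apply: (avoid t tl sep) => q.
have := res q; rewrite lineD /residual /= addrA => /le_trans; apply.
by rewrite ge_min lexx orbT.
Qed.

Lemma perturbation_sequence (f : R -> R) (k b0 : R) (P : nat -> system R)
    (l : nat -> R) :
  k.-lipschitz f -> 0 <= k -> (forall n, 0 < l n) -> 0 < b0 ->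
  exists (F : nat -> R[i] -> R[i]) (b : nat -> R),
    [/\ F 0%N = fun=> 0, b 0%N = b0, forall n, 0 <= b n,
      forall n, b n.+1 <= b n / 2 &
      forall n, [/\ real_on_line (F n),
        C11_bound S (b n / 2)%:C (fun z => F n.+1 z - F n z) &
        robustly_avoids (f \+ on_line (F n.+1)) (P n) (l n) (b n.+1)]].
Proof.
move=> fL k0 l0 b00; pose state := ((R[i] -> R[i]) * R)%type.
pose valid (s : state) :=
  [/\ real_on_line s.1, 0 < s.2 & exists M : R, C11_bound S M%:C s.1].
pose next n (s s' : state) := [/\ s'.2 <= s.2 / 2,
  C11_bound S (s.2 / 2)%:C (fun z => s'.1 z - s.1 z) &
  robustly_avoids (f \+ on_line s'.1) (P n) (l n) s'.2].
have step (p : nat * state) :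
    exists s', valid p.2 -> valid s' /\ next p.1 p.2 s'.
  case: p => n [F b] /=.
  have [[/= FR b_gt0 [M FC]]|] := pselect (valid (F, b)); last by exists (F, b).
  have [F' [b' [/andP[b'0 b'b] FR' FC' diffC avoid]]] :=
    perturbation_step (P n) fL k0 (l0 n) b_gt0 FR FC.
  exists (F', b') => _; split; last exact: And3 b'b diffC avoid.
  by split=> /=; [exact: FR'|exact: b'0|exists (M + b / 2); exact: FC'].
have [next_state next_stateP] := choice step.
pose s := fix s n := if n is m.+1 then next_state (m, s m) else (fun=> 0, b0).
have s_valid n : valid (s n).
  elim: n => [|n IH]; last by have [] := next_stateP (n, s n) IH.
  by split=> //; exists 0; exact: C11_bound0.
have s_next n : next n (s n) (s n.+1).
  by have [] := next_stateP (n, s n) (s_valid n).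
exists (fun n => (s n).1), (fun n => (s n).2); split=> // n.
- by have [_ /ltW] := s_valid n.
- by have [] := s_next n.
by have [? _ _] := s_valid n; have [] := s_next n.
Qed.

Lemma generic_perturbation (I : countType) (i0 : I) (P : I -> system R)
    (f : R -> R) (k eps : R) : k.-lipschitz f -> 0 <= k -> 0 < eps ->
  exists G : R[i] -> R[i], [/\ C11_bound S eps%:C G, real_on_line G &
    forall i, avoids (f \+ on_line G) (P i)].
Proof.
move=> fL k0 eps0; pose task n := odflt (i0, 0%N) (unpickle n).
have [F [b [F0 b_eps b0 bh FP]]] := perturbation_sequence
  (fun n => P (task n).1) fL k0 (fun n => ltr0Sn R (task n).2) eps0.
have FC n : C11_bound S (b n / 2)%:C (fun z => F n.+1 z - F n z).
  by case: (FP n).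
have [G GF] := C11_bound_halving_limit b0 bh FC.
have line_dist n (x : R) : `|G x%:C - F n x%:C| <= (b n)%:C.
  have Sx := strip_real x half_gt0; by case: (GF n _ _ _ Sx Sx Sx).
have GR : real_on_line G.
  move=> x; suff : complex.Im (G x%:C) = 0.
    by rewrite /on_line; case: (G _) => ? ? /= ->.
  have b_cvg0 := halving_cvg0 b0 bh; apply/eqP; rewrite -normr_le0.
  rewrite -(cvg_lim _ b_cvg0) //; apply: limr_ge; first exact: cvgP b_cvg0.
  apply: nearW => n; rewrite -lecR (le_trans _ (line_dist n x)) //.
  have [FR _ _] := FP n; rewrite FR (le_trans _ (normc_ge_Im _)) //.
  by rewrite ImB subr0.
exists G; split=> //.
- by rewrite -b_eps; apply: C11_bound_ext (GF 0%N) => z _; rewrite F0 subr0.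
move=> i; apply: robustly_avoids_avoids => n.
pose m := pickle (i, n); have [_ _] := FP m; rewrite /task pickleK /= => avoid.
apply: robustly_avoids_perturb avoid _ => x /=.
rewrite opprD addrACA subrr add0r distrC; have := line_dist m.+1 x.
by have [FR _ _] := FP m.+1; rewrite FR GR -rmorphB normc_real lecR.
Qed.

End GenericPerturbation.

(** * Approximation by smooth steps *)

Definition soft_step (R : rcfType) (d y : R) : R :=
  (1 + y / Num.sqrt (d ^+ 2 + y ^+ 2)) / 2.

Section SoftStep.
Context (R : realType) (d : R) (d0 : 0 < d).
Local Notation s y := (Num.sqrt (d ^+ 2 + y ^+ 2)).

Let s_sqr y : s y ^+ 2 = d ^+ 2 + y ^+ 2.
Proof. by rewrite sqr_sqrtr // addr_ge0 ?sqr_ge0. Qed.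

Let s_ge_d y : d <= s y.
Proof.
rewrite -[leLHS]ger0_norm ?(ltW d0) // -sqrtr_sqr ler_wsqrtr //.
by rewrite lerDl sqr_ge0.
Qed.

Let s_gt0 y : 0 < s y.
Proof. exact: lt_le_trans (s_ge_d y). Qed.

Let s_ge_norm y : `|y| <= s y.
Proof. by rewrite -sqrtr_sqr ler_wsqrtr // lerDr sqr_ge0. Qed.

Let s_le y : s y <= `|y| + d.
Proof.
rewrite -(ler_pXn2r (n := 2)) ?nnegrE ?sqrtr_ge0 ?addr_ge0 ?(ltW d0) // s_sqr.
rewrite sqrrD real_normK ?num_real // addrC lerD2r lerDl.
by rewrite mulrn_wge0 // mulr_ge0 // ltW.
Qed.

Let norm_ratio_le1 y : `|y / s y| <= 1.
Proof.
by rewrite normrM normfV (gtr0_norm (s_gt0 y)) ler_pdivrMr // mul1r s_ge_norm.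
Qed.

Lemma soft_step_sharp_le1 y : `|soft_step d y - (0 <= y)%R%:R| <= 1.
Proof.
have := norm_ratio_le1 y; rewrite /soft_step ler_norml => /andP[? ?].
rewrite ler_norml; case: (0 <= y); apply/andP; split;
  by rewrite ?mulr1n ?mulr0n; lra.
Qed.

Lemma soft_step_sharp_far (g y : R) : 0 < g -> g <= `|y| ->
  `|soft_step d y - (0 <= y)%R%:R| <= d / g.
Proof.
move=> g0 gy; apply: (@le_trans _ _ ((s y - `|y|) / s y)); last first.
  rewrite ler_pM ?invr_ge0 ?subr_ge0 ?(ltW (s_gt0 y)) //.
    by rewrite lerBlDl s_le.
  by rewrite lef_pV2 ?posrE // (le_trans gy).
have -> : (s y - `|y|) / s y = 1 - `|y| / s y by rewrite mulrBl divff // gt_eqF.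
have := norm_ratio_le1 y; rewrite ler_norml => /andP[? ?].
rewrite /soft_step ler_norml; case: (ger0P y) => y0;
  by rewrite ?mulr1n ?mulr0n ?mulNr; apply/andP; split; lra.
Qed.

Lemma klipschitz_soft_step : d^-1.-lipschitz (soft_step d : R -> R).
Proof.
apply/klipschitzP => x y; have sx := s_gt0 x; have sy := s_gt0 y.
have inv_le z : `|(s z)^-1| <= d^-1.
  by rewrite normfV (gtr0_norm (s_gt0 z)) lef_pV2 ?posrE.
have s_lip : `|s y - s x| <= `|x - y|.
  have sB : (s y - s x) * (s y + s x) = (y - x) * (y + x).
    by rewrite -!subr_sqr !s_sqr; ring.
  rewrite -(ler_pM2r (addr_gt0 sy sx)) -[X in _ * X <= _]gtr0_norm ?addr_gt0 //.
  rewrite -normrM sB normrM distrC ler_wpM2l //.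
  by rewrite (le_trans (ler_normD _ _)) // lerD.
have -> : soft_step d x - soft_step d y =
    2^-1 * ((x - y) / s x + y / s y * ((s y - s x) / s x)).
  by rewrite /soft_step; field; rewrite !gt_eqF.
rewrite normrM gtr0_norm ?invr_gt0 // ler_pdivrMl //.
rewrite (le_trans (ler_normD _ _)) // mulr_natl mulr2n lerD //.
  by rewrite normrM mulrC ler_wpM2r.
by rewrite normrM -[leRHS]mul1r ler_pM // normrM mulrC ler_pM.
Qed.

End SoftStep.

Definition soft_step_sum (R : rcfType) (n : nat) (d c0 : R) (c t : 'I_n -> R)
    (x : R) : R :=
  c0 + \sum_k c k * soft_step d (x - t k).

Lemma klipschitz_soft_step_sum (R : realType) (n : nat) (d c0 : R)
    (c t : 'I_n -> R) :
  0 < d -> (\sum_k `|c k| * d^-1).-lipschitz (soft_step_sum d c0 c t : R -> R).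
Proof.
move=> d0; apply/klipschitzP => x y.
rewrite opprD addrACA subrr add0r -sumrB mulr_suml.
rewrite (le_trans (ler_norm_sum _ _ _)) //; apply: ler_sum => k _.
rewrite -mulrBr normrM -mulrA ler_wpM2l //.
have /klipschitzP/(_ (x - t k) (y - t k)) := @klipschitz_soft_step R d d0.
by rewrite opprB addrA subrK.
Qed.

Lemma sum_near_integers_le2 (R : archiRealFieldType) (K : nat) (y : R) :
  \sum_(k < K) (`|y - k%:R| < 1)%R%:R <= 2 :> R.
Proof.
rewrite -natr_sum (ler_nat R _ 2) -big_mkcond /= sum1dep_card cardE.
rewrite -(size_map (fun k : 'I_K => (val k)%:Z)).
pose s := [:: Num.floor y; Num.floor y + 1]; apply: (@uniq_leq_size _ _ s).
  by rewrite map_inj_uniq ?enum_uniq // => k k' [] /val_inj.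
move=> _ /mapP[k + ->]; rewrite mem_enum inE ltr_norml => /andP[yk1 yk2].
have kE : (val k)%:~R = k%:R :> R by [].
rewrite !inE; have [ky|yk] := leP k%:R y; apply/orP.
  left; rewrite eq_sym floor_eq intrD kE ky /=; lra.
right; rewrite -subr_eq eq_sym floor_eq subrK intrB kE yk andbT; lra.
Qed.

Lemma sum_soft_sharp_le3 (R : realType) (K : nat) (d a g x : R) :
  0 < d -> 0 < g -> d * K%:R <= g ->
  \sum_(k < K)
    `|soft_step d (x - (a + k%:R * g)) - (a + k%:R * g <= x)%R%:R| <= 3.
Proof.
move=> d0 g0 dK; pose y := (x - a) / g.
pose bound (k : 'I_K) := d / g + (`|y - k%:R| < 1)%R%:R.
apply: (@le_trans _ _ (\sum_k bound k)); last first.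
  rewrite big_split /= sumr_const card_ord -[3]/(1 + 2).
  rewrite lerD ?sum_near_integers_le2 // -mulrnAl ler_pdivrMr // mul1r.
  by rewrite -mulr_natr.
apply: ler_sum => k _; rewrite /bound.
have yk : x - (a + k%:R * g) = (y - k%:R) * g.
  by rewrite /y; field; rewrite gt_eqF.
rewrite -[_ <= x]subr_ge0; have [near|far] := ltP `|y - k%:R| 1.
  rewrite (le_trans (soft_step_sharp_le1 d0 _)) // mulr1n lerDr.
  by rewrite divr_ge0 // ltW.
rewrite mulr0n addr0; apply: soft_step_sharp_far => //.
by rewrite yk normrM (gtr0_norm g0) ler_peMl // ltW.
Qed.

Lemma sharp_step_sum_value (R : realDomainType) (f : R -> R) (t : nat -> R)
    (K : nat) (x : R) : {homo t : i j / (i <= j)%N >-> i <= j} ->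
  exists j, [/\ (j <= K)%N,
    f (t 0%N) + \sum_(k < K) (f (t k.+1) - f (t k)) * (t k.+1 <= x)%R%:R =
      f (t j),
    j = 0%N \/ t j <= x & j = K \/ x < t j.+1].
Proof.
move=> t_homo; elim: K => [|K [j [jK jE j0 jx]]].
  by exists 0%N; rewrite big_ord0 addr0; split=> //; left.
rewrite big_ord_recr /= addrA jE; have [tx|xt] := leP (t K.+1) x.
  have -> : j = K.
    case: jx => // xj; have := lt_le_trans xj (t_homo j.+1 K.+1 jK).
    by rewrite ltNge tx.
  exists K.+1; split=> //; [|by right|by left].
  by rewrite mulr1n mulr1 addrC subrK.
exists j; rewrite mulr0n mulr0 addr0; split=> //; first exact: leqW.
by right; case: jx => // ->.
Qed.

Lemma sharp_step_sum_close (R : realFieldType) (f : R -> R) (e a g : R)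
    (K : nat) (x : R) : 0 <= e -> 0 < g ->
  (forall y z, `|y - z| <= g -> `|f y - f z| <= e) ->
  (forall y, y <= a -> `|f y - f a| <= e) ->
  (forall y, a + K%:R * g <= y -> `|f y - f (a + K%:R * g)| <= e) ->
  `|f x - (f a + \sum_(k < K) (f (a + k.+1%:R * g) - f (a + k%:R * g)) *
      (a + k.+1%:R * g <= x)%R%:R)| <= e.
Proof.
move=> e0 g0 fg fa fb; pose t k := a + k%:R * g.
have tS k : t k.+1 = t k + g by rewrite /t -natr1; ring.
have t_homo : {homo t : i j / (i <= j)%N >-> i <= j}.
  by move=> i j ij; rewrite lerD2l ler_pM2r // ler_nat.
have [j [_ + tj jx]] := sharp_step_sum_value f K x t_homo.
have t0 : t 0%N = a by rewrite /t mul0r addr0.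
rewrite t0 => ->; have [xt|tx] := ltP x (t j).
  case: tj => [j0|]; last by rewrite leNgt xt.
  by move: xt; rewrite j0 t0 => /ltW/fa.
case: jx => [jK|]; first by rewrite jK; apply: fb; rewrite -/(t K) -jK.
by rewrite tS => xt; apply: fg; rewrite ger0_norm ?subr_ge0 // lerBlDl ltW.
Qed.

Lemma cvg_pinfty_oscillation (R : realType) (f : R -> R) (e : R) :
  cvg (f x @[x --> +oo]) -> 0 < e ->
  \forall T \near +oo, forall x y, T <= x -> T <= y -> `|f x - f y| <= e.
Proof.
move=> /cvg_ex[l /cvgrPdist_le fl] e0; have e2 : 0 < e / 2 by rewrite divr_gt0.
have [T [Treal fT]] := fl _ e2; exists T; split=> // T' TT' x y Tx Ty.
have -> : f x - f y = (l - f y) - (l - f x) by ring.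
rewrite (le_trans (ler_normB _ _)) // [leRHS]splitr lerD //.
  exact/fT/(lt_le_trans TT').
exact/fT/(lt_le_trans TT').
Qed.

Lemma cvg_ninfty_oscillation (R : realType) (f : R -> R) (e : R) :
  cvg (f x @[x --> -oo]) -> 0 < e ->
  \forall T \near +oo, forall x y, x <= - T -> y <= - T -> `|f x - f y| <= e.
Proof.
move=> /cvg_ex[l /cvgNy_compNP fl] e0.
have fN : cvg ((f \o -%R) x @[x --> +oo]) by apply/cvg_ex; exists l.
apply: filterS (cvg_pinfty_oscillation fN e0) => T fT x y xT yT.
by have := fT (- x) (- y); rewrite /= !opprK; apply; rewrite lerNr.
Qed.

Lemma tails_oscillation (R : realType) (f : R -> R) (e : R) :
  cvg (f x @[x --> +oo]) -> cvg (f x @[x --> -oo]) -> 0 < e ->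
  exists T, (forall x y, T <= x -> T <= y -> `|f x - f y| <= e) /\
    (forall x y, x <= - T -> y <= - T -> `|f x - f y| <= e).
Proof.
move=> f_top f_bot e0; near (+oo_R) => T; exists T; split.
- by near: T; exact: cvg_pinfty_oscillation.
- by near: T; exact: cvg_ninfty_oscillation.
Unshelve. all: by end_near. Qed.

Lemma soft_step_approximation (R : realType) (f : R -> R) (eps : R) :
  unif_continuous f ->
  cvg (f x @[x --> +oo]) -> cvg (f x @[x --> -oo]) -> 0 < eps ->
  exists n d c0 (c t : 'I_n -> R), [/\ 0 < d, d <= 1 &
    forall x, `|f x - soft_step_sum d c0 c t x| <= eps].
Proof.
move=> /unif_continuousP f_unif f_top f_bot eps0; pose e := eps / 4.
have e0 : 0 < e by rewrite divr_gt0.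
have [r r0 fr] := f_unif _ e0; pose g := r / 2.
have g0 : 0 < g by rewrite divr_gt0.
have fg x y : `|x - y| <= g -> `|f x - f y| <= e.
  move=> xyg; apply/ltW/(fr (x, y)); rewrite /ball /= (le_lt_trans xyg) //.
  by rewrite ltr_pdivrMr // ltr_pMr // ltr1n.
have [T [top bot]] := tails_oscillation f_top f_bot e0.
pose K := (Num.truncn (2 * T / g)).+1.
have KT : T < - T + K%:R * g.
  have : 2 * T < K%:R * g by rewrite -ltr_pdivrMr // truncnS_gt.
  lra.
pose d := Num.min 1 (g / K%:R).
have d0 : 0 < d by rewrite lt_min ltr01 divr_gt0.
have dK : d * K%:R <= g by rewrite -ler_pdivlMr // ge_min lexx orbT.
pose t k := - T + k%:R * g; pose c (k : 'I_K) := f (t k.+1) - f (t k).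
exists K, d, (f (- T)), c, (fun k => t k.+1); split=> // [|x].
  by rewrite ge_min lexx.
pose err (k : 'I_K) := soft_step d (x - t k.+1) - (t k.+1 <= x)%R%:R.
have -> : f x - soft_step_sum d (f (- T)) c (fun k => t k.+1) x =
    (f x - (f (- T) + \sum_(k < K) c k * (t k.+1 <= x)%R%:R)) -
    \sum_(k < K) c k * err k.
  rewrite /soft_step_sum /err; under [X in _ = _ - X]eq_bigr do rewrite mulrBr.
  by rewrite sumrB; ring.
have sharp_close :
    `|f x - (f (- T) + \sum_(k < K) c k * (t k.+1 <= x)%R%:R)| <= e.
  apply: sharp_step_sum_close (ltW e0) g0 fg _ _ => y yT; first exact: bot.
  by apply: top; rewrite ?(le_trans (ltW KT)) // ltW.
have err_small : `|\sum_(k < K) c k * err k| <= e * 3.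
  rewrite (le_trans (ler_norm_sum _ _ _)) //.
  have := sum_soft_sharp_le3 (- T + g) x d0 g0 dK; rewrite -(ler_pM2l e0).
  apply: le_trans; rewrite mulr_sumr; apply: ler_sum => k _.
  have tE : t k.+1 = - T + g + k%:R * g by rewrite /t -natr1; ring.
  have tS : t k.+1 - t k = g by rewrite /t -natr1; ring.
  by rewrite normrM ler_pM // /err -?tE //; apply: fg; rewrite tS gtr0_norm.
rewrite (le_trans (ler_normB _ _)) //.
rewrite (le_trans (lerD sharp_close err_small)) //.
by rewrite /e; lra.
Qed.

(** * Variation of a piecewise smooth function *)

Lemma continuous_itvoo_extension (R : realFieldType) (f : R -> R) (a b : R) :
  a < b -> (forall x, a < x < b -> {for x, continuous f}) ->
  cvg (f x @[x --> a^'+]) -> cvg (f x @[x --> b^'-]) ->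
  exists2 g, {within `[a, b], continuous g} & forall x, a < x < b -> g x = f x.
Proof.
move=> ab fc fa fb.
pose g x := if x <= a then lim (f x @[x --> a^'+])
            else if b <= x then lim (f x @[x --> b^'-]) else f x.
have gE x : a < x < b -> g x = f x.
  by move=> /andP[ax xb]; rewrite /g leNgt ax leNgt xb.
exists g => //; apply/continuous_within_itvP => //; split.
- move=> x; rewrite in_itv /= => xab; have := fc x xab.
  rewrite /continuous_at gE //; case/andP: xab => ax xb; apply: cvg_trans.
  apply: near_eq_cvg; near=> y; apply/esym/gE/andP; split; near: y.
    exact: lt_nbhsr.
  exact: lt_nbhsl.
- rewrite {2}/g lexx; apply: cvg_trans fa; apply: near_eq_cvg; near=> y.
  by apply/esym/gE/andP; split; near: y;
    [exact: nbhs_right_gt|exact: nbhs_right_lt].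
rewrite {2}/g leNgt ab lexx; apply: cvg_trans fb; apply: near_eq_cvg; near=> y.
by apply/esym/gE/andP; split; near: y;
  [exact: nbhs_left_gt|exact: nbhs_left_lt].
Unshelve. all: by end_near. Qed.

Section Variation.
Context (R : realType) (f : R -> R) (f_cont : continuous f).
Context (f'_L1 : (@lebesgue_measure R).-integrable setT (EFin \o f^`())).
Local Notation mu := (@lebesgue_measure R).

Definition variation (x : R) : R := \int[mu]_(z in `]-oo, x]) `|derive1 f z|.

Let norm_f'_L1 (A : set R) : measurable A ->
  mu.-integrable A (EFin \o (Num.norm \o derive1 f)).
Proof. by move=> mA; apply: integrable_norm; apply: integrableS f'_L1. Qed.

Lemma variation_ge0 x : 0 <= variation x.
Proof. exact: Rintegral_ge0. Qed.

Lemma variationB x y : x <= y ->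
  variation y - variation x = \int[mu]_(z in `]x, y]) `|derive1 f z|.
Proof.
by move=> xy; apply: Rintegral_itvB; rewrite ?bnd_simp //; exact: norm_f'_L1.
Qed.

Lemma has_ubound_variation : has_ubound (range variation).
Proof.
exists (\int[mu]_(z in `]-oo, +oo[) `|derive1 f z|) => _ [x _ <-].
rewrite -subr_ge0 /variation Rintegral_itvB // ?Rintegral_ge0 //.
exact: norm_f'_L1.
Qed.

Lemma variation_absolutely_continuous e : 0 < e -> exists2 g, 0 < g &
  forall x y, x <= y -> y - x < g -> variation y - variation x < e.
Proof.
move=> /(integral_normr_continuous f'_L1)[g [g0 fg]]; exists g => // x y xy yxg.
rewrite variationB //; apply: fg => //.
rewrite [X in (X < _)%E]lebesgue_measure_itv /=.
case: ifP => _; last by rewrite lte_fin.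
by rewrite -EFinB lte_fin.
Qed.

Lemma smooth_piece_variation a b : a < b ->
  (forall x, a < x < b -> derivable f x 1 /\ {for x, continuous f^`()}) ->
  cvg (f^`() x @[x --> a^'+]) -> cvg (f^`() x @[x --> b^'-]) ->
  `|f b - f a| <= variation b - variation a.
Proof.
move=> ab f_C1 f'a f'b.
have [g gc gE] :=
  continuous_itvoo_extension ab (fun x xab => (f_C1 x xab).2) f'a f'b.
have f_LR : derivable_oo_LRcontinuous f a b.
  split.
  - by move=> x; rewrite in_itv /= => xab; have [df _] := f_C1 x xab.
  - by apply: cvg_at_right_filter; exact: f_cont.
  - by apply: cvg_at_left_filter; exact: f_cont.
have FTC : \int[mu]_(x in `[a, b]) g x = f b - f a.
  rewrite /Rintegral (continuous_FTC2 ab gc f_LR) // => x.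
  by rewrite in_itv /= => xab; rewrite gE.
have gL1 : mu.-integrable `[a, b] (EFin \o g).
  by apply: continuous_compact_integrable => //; exact: segment_compact.
rewrite -FTC variationB ?(ltW ab) // (le_trans (le_normr_Rintegral _ _)) //.
have gL1' : mu.-integrable `]a, b] (EFin \o g).
  by apply: integrableS gL1 => //; exact: subset_itv_oc_cc.
have gL1'' : mu.-integrable `]a, b[ (EFin \o g).
  by apply: integrableS gL1 => //; exact: subset_itv_oo_cc.
rewrite -Rintegral_itv_obnd_cbnd; last exact: integrable_norm.
rewrite -Rintegral_itv_bndo_bndc; last exact: integrable_norm.
rewrite -[leRHS]Rintegral_itv_bndo_bndc; last exact: norm_f'_L1.
rewrite le_eqVlt; apply/orP; left; apply/eqP; apply: eq_Rintegral => x.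
by rewrite inE /= in_itv /= => xab; rewrite gE.
Qed.

End Variation.

Lemma piecewise_C1_variation (R : realType) (f : R -> R) (x y : R) :
  piecewise_C1 f -> (@lebesgue_measure R).-integrable setT (EFin \o f^`()) ->
  x <= y -> `|f y - f x| <= variation f y - variation f x.
Proof.
move=> [f_cont [S [S_fin S_reg S_lim]]] f'_L1; pose V := variation f.
rewrite le_eqVlt => /predU1P[->|]; first by rewrite !subrr normr0.
suff pieces (s : seq R) a b :
    a < b -> (forall p, S p -> a < p < b -> p \in s) ->
    `|f b - f a| <= V b - V a.
  move=> xy; have /finite_seqP[s sE] := S_fin x y.
  apply: (pieces s) => // p Sp /andP[xp py].
  have : (S `&` `[x, y]) p by split=> //=; rewrite in_itv /= !ltW.
  by rewrite sE.
elim: s a b => [|p s IH] a b ab sP.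
  apply: smooth_piece_variation => //.
  - by move=> z zab; apply: S_reg => Sz; have := sP z Sz zab; rewrite in_nil.
  - have [/S_lim[] //|/S_reg[_ f'a]] := pselect (S a).
    by apply/cvg_ex; exists (f^`() a); apply: cvg_at_right_filter; exact: f'a.
  - have [/S_lim[] //|/S_reg[_ f'b]] := pselect (S b).
    by apply/cvg_ex; exists (f^`() b); apply: cvg_at_left_filter; exact: f'b.
have [/andP[ap pb]|not_apb] := boolP (a < p < b); last first.
  apply: IH => // q Sq qab; have := sP q Sq qab; rewrite in_cons.
  by case/predU1P => // qp; rewrite -qp qab in not_apb.
have left_piece : `|f p - f a| <= V p - V a.
  apply: IH => // q Sq /andP[aq qp].
  by have := sP q Sq; rewrite aq (lt_trans qp pb) in_cons (lt_eqF qp) /=; exact.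
have right_piece : `|f b - f p| <= V b - V p.
  apply: IH => // q Sq /andP[pq qb].
  by have := sP q Sq; rewrite (lt_trans ap pq) qb in_cons (gt_eqF pq) /=; exact.
have -> : f b - f a = (f b - f p) + (f p - f a) by ring.
have -> : V b - V a = (V b - V p) + (V p - V a) by ring.
by rewrite (le_trans (ler_normD _ _)) // lerD.
Qed.

Lemma monotone_increments_cvg (R : realType) (f V : R -> R) :
  (forall x y, x <= y -> `|f y - f x| <= V y - V x) -> has_ubound (range V) ->
  cvg (f x @[x --> +oo]).
Proof.
move=> fV [B VB]; have V_le x : V x <= B by apply: VB; exists x.
have V_mono : nondecreasing_fun V.
  by move=> x y /fV/(le_trans (normr_ge0 _)); rewrite subr_ge0.
have Vf_mono : nondecreasing_fun (V \+ f).
  by move=> x y /fV; rewrite ler_norml /= => /andP[? _]; lra.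
have Vf_bounded : has_ubound (range (V \+ f)).
  exists (f 0 + 2 * B - V 0) => _ [x _ <-] /=; have := V_le x; have := V_le 0.
  by have [/fV|/ltW/fV] := leP 0 x; rewrite ler_norml => /andP[? ?]; lra.
have -> : f = (V \+ f) \- V by apply/funext => x /=; rewrite addrC addKr.
apply: is_cvgB; apply/cvg_ex; eexists; apply: nondecreasing_cvgr => //.
by exists B.
Qed.

Lemma piecewise_C1_cvg (R : realType) (f : R -> R) :
  piecewise_C1 f -> (@lebesgue_measure R).-integrable setT (EFin \o f^`()) ->
  cvg (f x @[x --> +oo]) /\ cvg (f x @[x --> -oo]).
Proof.
move=> f_C1 f'_L1; have fV x y := @piecewise_C1_variation R f x y f_C1 f'_L1.
split; first exact: monotone_increments_cvg fV (has_ubound_variation f'_L1).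
have /cvg_ex[l fl] : cvg ((f \o -%R) x @[x --> +oo]).
  apply: (@monotone_increments_cvg _ _ (- (variation f \o -%R))) => [x y xy|].
    by rewrite /= opprK [leRHS]addrC distrC fV // lerN2.
  by exists 0 => _ [x _ <-]; rewrite oppr_le0 variation_ge0.
by apply/cvg_ex; exists l; apply/cvgNy_compNP.
Qed.

Lemma piecewise_C1_unif_continuous (R : realType) (f : R -> R) :
  piecewise_C1 f -> (@lebesgue_measure R).-integrable setT (EFin \o f^`()) ->
  unif_continuous f.
Proof.
move=> f_C1 f'_L1; apply/unif_continuousP => e e0.
have [g g0 Vg] := variation_absolutely_continuous f'_L1 e0.
exists g => // -[x y] /=; rewrite /ball /=.
wlog xy : x y / x <= y => [increasing|].
  have [xy|/ltW yx] := leP x y; first exact: increasing.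
  by move=> xyg; rewrite distrC; apply: increasing => //; rewrite distrC.
rewrite distrC ger0_norm ?subr_ge0 // => yxg; rewrite distrC.
exact: le_lt_trans (piecewise_C1_variation f_C1 f'_L1 xy) (Vg x y xy yxg).
Qed.

(** * Holomorphic smooth steps *)

Lemma square_root_derivable (K : numFieldType) (s : K -> K) (w r : K) :
  0 < r -> (forall z, s z ^+ 2 = z) -> (forall z, r <= `|s z + s w|) ->
  derivable s w 1.
Proof.
move=> r0 s_sqr sum_ge.
have sum_neq0 z : s z + s w != 0 by rewrite -normr_gt0 (lt_le_trans r0).
have sB z : s z - s w = (z - w) / (s z + s w).
  by apply: (canRL (mulfK (sum_neq0 z))); rewrite -subr_sqr !s_sqr.
apply/cvg_ex; exists (s w + s w)^-1; apply/cvgrPdist_le => e e0; near=> h.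
have h0 : h != 0 by near: h; exact: nbhs_dnbhs_neq.
have he : `|h| < e * r ^+ 3.
  by near: h; apply: dnbhs0_lt; rewrite mulr_gt0 ?exprn_gt0.
rewrite /= [h *: 1]mulr1 sB addrK /GRing.scale /= mulKf //.
have -> : (s w + s w)^-1 - (s (h + w) + s w)^-1 =
    h / ((s w + s w) * (s (h + w) + s w) ^+ 2).
  have hE : (s (h + w) - s w) * (s (h + w) + s w) = h by rewrite sB addrK divfK.
  by rewrite -[X in _ = X / _]hE; field; rewrite !sum_neq0.
rewrite normrM normfV ler_pdivrMr ?normr_gt0 ?mulf_neq0 ?expf_neq0 //.
rewrite (le_trans (ltW he)) // ler_wpM2l ?(ltW e0) // normrM normrX exprS.
by rewrite ler_pM ?exprn_ge0 ?lerXn2r ?nnegrE // ltW.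
Unshelve. all: by end_near. Qed.

Lemma root_ratio_derivable (K : numFieldType) (s : K^o -> K^o) (c a z : K) :
  derivable s (c + (z - a) ^+ 2) 1 -> s (c + (z - a) ^+ 2) != 0 ->
  derivable (fun w : K^o => (1 + (w - a) / s (c + (w - a) ^+ 2)) / 2 : K^o) z 1.
Proof.
move=> ds s0.
have shift_derivable : derivable ((id : K^o -> K^o) - cst (a : K^o)) z 1.
  by apply: derivableB; [exact: derivable_id|exact: derivable_cst].
have inner_derivable :
    derivable (cst (c : K^o) + ((id : K^o -> K^o) - cst (a : K^o)) ^+ 2) z 1.
  by apply: derivableD; [exact: derivable_cst|exact: derivableX].
have root_derivable : derivable (fun w : K^o => s (c + (w - a) ^+ 2) : K^o) z 1.
  apply/derivable1_diffP.
  by apply: (@differentiable_comp _ _ _ _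
    (fun w : K^o => c + (w - a) ^+ 2 : K^o) s); exact/derivable1_diffP.
have ratio := derivableM shift_derivable (derivableV s0 root_derivable).
have sum := derivableD (derivable_cst (1 : K^o) z 1) ratio.
exact: (derivableM sum (derivable_cst (2^-1 : K^o) z 1)).
Qed.

Lemma Re_sqrtc_ge0 (R : rcfType) (w : R[i]) : 0 <= complex.Re (sqrtc w).
Proof. by case: w => a b /=; exact: sqrtr_ge0. Qed.

Lemma Re_sqrtc_gt0 (R : rcfType) (w : R[i]) :
  0 < complex.Re w -> 0 < complex.Re (sqrtc w).
Proof. by case: w => a b /= a0; rewrite sqrtr_gt0 divr_gt0 // ltr_wpDl. Qed.

Section ComplexSteps.
Context (R : realType).
Implicit Types (d t : R) (z w : R[i]).

Lemma sqrtc_derivable (w : R[i]^o) : 0 < complex.Re w ->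
  derivable (@sqrtc R : R[i]^o -> R[i]^o) w 1.
Proof.
move=> w0; have r0 : 0 < (complex.Re (sqrtc w))%:C by rewrite ltcR Re_sqrtc_gt0.
apply: square_root_derivable r0 (@sqr_sqrtc R) _ => z.
rewrite (le_trans _ (normc_ge_Re _)) // lecR (le_trans _ (ler_norm _)) //.
have -> : complex.Re (sqrtc z + sqrtc w) =
    complex.Re (sqrtc z) + complex.Re (sqrtc w).
  by case: (sqrtc z) (sqrtc w) => ? ? [].
by rewrite lerDr Re_sqrtc_ge0.
Qed.

Definition complex_soft_step d (z : R[i]) : R[i] :=
  (1 + z / sqrtc (d%:C ^+ 2 + z ^+ 2)) / 2.

Lemma complex_soft_step_real d x :
  complex_soft_step d x%:C = (soft_step d x)%:C.
Proof.
rewrite /complex_soft_step /soft_step -!rmorphXn -rmorphD.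
rewrite sqrtc_sqrtr /=; last by rewrite ler0c addr_ge0 ?sqr_ge0.
by rewrite fmorph_div rmorphD rmorph1 fmorph_div rmorph_nat.
Qed.

Lemma complex_soft_step_derivable d t (z : R[i]^o) : 0 < d -> strip (d / 2) z ->
  derivable (fun w : R[i]^o => complex_soft_step d (w - t%:C) : R[i]^o) z 1.
Proof.
move=> d0 zd; have Re_gt0 : 0 < complex.Re (d%:C ^+ 2 + (z - t%:C) ^+ 2).
  case: z zd => x y zd; have yd : `|y| < d / 2 by exact: zd.
  have -> : complex.Re (d%:C ^+ 2 + (x +i* y - t%:C) ^+ 2) =
      d ^+ 2 + (x - t) ^+ 2 - y ^+ 2 by rewrite !expr2 /=; ring.
  have : y ^+ 2 < d ^+ 2.
    rewrite -real_normK ?num_real // ltr_pXn2r ?nnegrE ?(ltW d0) //.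
    by rewrite (lt_trans yd) // ltr_pdivrMr // ltr_pMr // ltr1n.
  by have := sqr_ge0 (x - t); lra.
apply: (root_ratio_derivable (sqrtc_derivable Re_gt0)).
by apply: contraTneq (Re_sqrtc_gt0 Re_gt0) => ->; rewrite ltxx.
Qed.

End ComplexSteps.

Lemma derivable_affine_sum (K : numFieldType) (n : nat) (c0 : K) (c : 'I_n -> K)
    (f : 'I_n -> K^o -> K^o) (z : K^o) :
  (forall k, derivable (f k) z 1) ->
  derivable (fun w : K^o => c0 + \sum_k c k * f k w : K^o) z 1.
Proof.
move=> df.
have dk k : derivable (cst (c k : K^o) * f k) z 1 by exact: derivableM.
have := derivableD (derivable_cst (c0 : K^o) z 1) (derivable_sum dk).
congr (derivable _ z 1); apply/funext => w.
by rewrite {1}/GRing.add /= fct_sumE.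
Qed.

Section ComplexStepSum.
Context (R : realType) (n : nat) (d c0 : R) (c t : 'I_n -> R).

Definition complex_soft_step_sum (z : R[i]) : R[i] :=
  c0%:C + \sum_k (c k)%:C * complex_soft_step d (z - (t k)%:C).

Lemma complex_soft_step_sum_real x :
  complex_soft_step_sum x%:C = (soft_step_sum d c0 c t x)%:C.
Proof.
rewrite rmorphD rmorph_sum; congr (_ + _); apply: eq_bigr => k _.
by rewrite rmorphM -rmorphB complex_soft_step_real.
Qed.

Lemma complex_soft_step_sum_derivable (z : R[i]^o) : 0 < d -> strip (d / 2) z ->
  derivable (complex_soft_step_sum : R[i]^o -> R[i]^o) z 1.
Proof.
move=> d0 zd; apply: (@derivable_affine_sum R[i] n c0%:C (fun k => (c k)%:C)
  (fun k w => complex_soft_step d (w - (t k)%:C)) z) => k.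
exact: complex_soft_step_derivable.
Qed.

End ComplexStepSum.

(** * Rational sample points *)

Lemma dense_rational_matrices (R : realType) (m n : nat) :
  dense (range (map_mx (@ratr R) : 'M[rat]_(m, n) -> 'M[R]_(m, n))).
Proof.
move=> U [A UA] oU.
have /nbhs_ballP[r /= r0 Ur] : nbhs A U by exact: open_nbhs_nbhs.
have /choice[q q_itv] (ij : 'I_m * 'I_n) : exists q : rat,
    ratr q \in `](A ij.1 ij.2 - r), (A ij.1 ij.2 + r)[%R.
  by apply: rat_in_itvoo; lra.
exists (map_mx ratr (\matrix_(i, j) q (i, j))); split; last by eexists.
apply: Ur; split=> // i j; rewrite !mxE /ball /= ltr_norml.
have := q_itv (i, j); rewrite in_itv /= => /andP[? ?].
by apply/andP; split; lra.
Qed.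

Lemma open_dense_nonvanishing (T : topologicalType) (R : realType) (I : Type)
    (r : seq I) (G : I -> T -> R) :
  (forall i, continuous (G i)) -> (forall i, dense [set x | G i x != 0]) ->
  open [set x | all (fun i => G i x != 0) r] /\
  dense [set x | all (fun i => G i x != 0) r].
Proof.
move=> Gc Gd; elim: r => [|i r [IHo IHd]] /=.
  have -> : [set x : T | true] = setT by apply/seteqP; split.
  by split; [exact: openT|move=> O O0 _; rewrite setIT].
have oGi : open [set x | G i x != 0].
  apply: (@open_comp _ _ (G i) [set y | y != 0]); last exact: open_neq.
  by move=> x _; exact: Gc.
have -> : [set x | (G i x != 0) && all (fun i => G i x != 0) r] =
    [set x | G i x != 0] `&` [set x | all (fun i => G i x != 0) r].
  by apply/seteqP; split=> x /= /andP.
by split; [exact: openI|exact: denseI].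
Qed.

Definition sample_point (R : realType) (D : nat) (X : seq 'cV[rat]_D)
    (m : nat) : 'cV[R]_D := map_mx ratr X`_m.

Section SamplePoints.
Context (R : realType) (D : nat) (K : finType) (F : K -> 'cV[R]_D -> R).
Context (F_cont : forall k, continuous (F k)).
Context (F_neq : forall k k', k != k' -> dense [set x | F k x - F k' x != 0]).
Context (F_nonconstant : forall k c, dense [set x | F k x - c != 0]).
Context (U : set 'cV[R]_D) (oU : open U) (U_nonempty : U !=set0).

Lemma fresh_rational_point (ys : seq R) : exists xi : 'cV[rat]_D,
  [/\ U (map_mx ratr xi), injective (fun k => F k (map_mx ratr xi)) &
      forall k, F k (map_mx ratr xi) \notin ys].
Proof.
pose G (i : (K * K) + (K * 'I_(size ys))) : 'cV[R]_D -> R := match i with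
  | inl (k, k') => if k == k' then cst 1 else F k - F k'
  | inr (k, j) => F k - cst ys`_j
  end.
have Gc i : continuous (G i).
  case: i => [[k k']|[k j]] x /=.
    case: eqP => _; first exact: cst_continuous.
    by apply: continuousB; exact: F_cont.
  by apply: continuousB; [exact: F_cont|exact: cst_continuous].
have Gd i : dense [set x | G i x != 0].
  case: i => [[k k']|[k j]] /=; last exact: F_nonconstant.
  case: eqVneq => [_|]; last exact: F_neq.
  move=> O O0 _; have -> : [set x : 'cV[R]_D | cst 1 x != 0 :> R] = setT.
    by apply/seteqP; split=> x //= _; exact: oner_neq0.
  by rewrite setIT.
have [oG dG] :=
  open_dense_nonvanishing (enum {: (K * K) + (K * 'I_(size ys))}) Gc Gd.
have [x [[Ux /allP G0] [xi _ xE]]] :=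
  dense_rational_matrices (dG U U_nonempty oU) (openI oU oG).
subst x; exists xi; split=> // [k k' Fkk'|k].
  apply/eqP; have := G0 (inl (k, k')) (mem_enum _ _).
  by rewrite /=; case: (k == k') => //; rewrite !fctE Fkk' subrr eqxx.
apply/negP => /(nthP 0)[j jlt yj].
have := G0 (inr (k, Ordinal jlt)) (mem_enum _ _).
by rewrite /= !fctE yj subrr eqxx.
Qed.

Lemma separating_rational_points (M : nat) : exists X : seq 'cV[rat]_D,
  [/\ size X = M, forall m, (m < M)%N -> U (sample_point R X m) &
      injective (fun p : 'I_M * K => F p.2 (sample_point R X p.1))].
Proof.
elim: M => [|M [X [sX XU X_inj]]]; first by exists [::]; split=> // -[[]].
have [xi [xiU xi_inj xi_fresh]] :=
  fresh_rational_point [seq F p.2 (sample_point R X p.1) | p : 'I_M * K].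
exists (xi :: X); split=> [|[|m] mM|[m k] [m' k'] /=]; rewrite /= ?sX //;
  first exact: XU.
have old_new m0 k0 k1 : F k0 (sample_point R X m0) = F k1 (map_mx ratr xi) ->
    (m0 < M)%N -> False.
  move=> FE m0M; have /negP := xi_fresh k1; apply; rewrite -FE.
  by apply/mapP; exists (Ordinal m0M, k0); rewrite ?mem_enum.
case: (unliftP ord0 m) => [m0|] ->; case: (unliftP ord0 m') => [m0'|] ->;
  rewrite ?lift0 /=.
- by move=> FE; have [-> ->] := X_inj (m0, k) (m0', k') FE.
- by move=> FE; case: (old_new _ _ _ FE).
- by move=> /esym FE; case: (old_new _ _ _ FE).
- by move=> /xi_inj ->.
Qed.

End SamplePoints.

(** * Relations between units *)

Definition num_samples (D u : nat) : nat := (u.+2 * (D + u).+1).+1.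

(* The equations at the sample points for [u] units with preactivations [b_i],
   and one more preactivation [a] with [sigma \o a] an affine combination of the
   coordinates and the [sigma \o b_i]. The [u + 2] affine forms are indexed by
   [Some (Some i)] for [b_i], [Some None] for [a] and [None] for the relation;
   unknown are their coefficients and the values of the [u] units at the sample
   points. *)
Section RelationSystem.
Context (R : realType) (D u : nat) (X : seq 'cV[rat]_D).
Local Notation M := (num_samples D u).

Definition relation_unknown : finType :=
  (option (option 'I_u) * option ('I_D + 'I_u) + 'I_M * 'I_u)%type.

Definition relation_equation : finType := ('I_M * option 'I_u)%type.

Implicit Type t : relation_unknown -> R.

Definition relation_form t (m : 'I_M) (k : option (option 'I_u)) : R :=
  t (inl (k, None)) +
  \sum_j t (inl (k, Some (inl j))) * sample_point R X m j 0 +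
  \sum_i t (inl (k, Some (inr i))) * t (inr (m, i)).

Definition relation_argument t (q : relation_equation) : R :=
  relation_form t q.1 (Some q.2).

Definition relation_value t (q : relation_equation) : R :=
  if q.2 is Some i then t (inr (q.1, i)) else relation_form t q.1 None.

Lemma relation_overdetermined : (#|relation_unknown| < #|relation_equation|)%N.
Proof.
rewrite card_sum !card_prod !card_option card_sum !card_ord.
by rewrite [X in (_ < X)%N]mulnS ltn_add2r.
Qed.

Lemma relation_form_lipschitz m k :
  lipschitz_on_cubes (fun t => relation_form t m k).
Proof.
apply: lipschitz_on_cubesD; first apply: lipschitz_on_cubesD.
- exact: lipschitz_on_cubes_coord.
- apply: lipschitz_on_cubes_sum => j; apply: lipschitz_on_cubesM.
    exact: lipschitz_on_cubes_coord.
  exact: lipschitz_on_cubes_cst.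
- apply: lipschitz_on_cubes_sum => i.
  by apply: lipschitz_on_cubesM; exact: lipschitz_on_cubes_coord.
Qed.

Lemma relation_argument_lipschitz q :
  lipschitz_on_cubes (relation_argument^~ q).
Proof. exact: relation_form_lipschitz. Qed.

Lemma relation_value_lipschitz q : lipschitz_on_cubes (relation_value^~ q).
Proof.
rewrite /relation_value; case: q.2 => [i|];
  first exact: lipschitz_on_cubes_coord.
exact: relation_form_lipschitz.
Qed.

Definition relation_system : system R :=
  System relation_overdetermined relation_argument_lipschitz
    relation_value_lipschitz.

End RelationSystem.

Definition generic_activation (R : realType) (D : nat) (sigma : R -> R)
    : Prop :=
  forall u X, avoids sigma (@relation_system R D u X).

Section Expansions.
Context (R : realType) (D : nat) (sigma : R -> R).
Context (sigma_cont : continuous sigma).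
Context (sigma_generic : generic_activation D sigma).
Local Notation E := ('cV[R]_D -> R).
Implicit Types (s : seq E) (f a : E) (c : E -> R) (th : R) (w : 'I_D -> R).

Definition expansion s th w c : E :=
  fun x => th + \sum_j w j * x j 0 + \sum_(f <- s) c f * sigma (f x).

Definition expands_in s f : Prop := exists th w c, f = expansion s th w c.

Definition locally_free s : Prop :=
  forall (U : set 'cV[R]_D) th w c, open U -> U !=set0 ->
    (forall x, U x -> expansion s th w c x = 0) ->
    [/\ th = 0, forall j, w j = 0 & forall f, f \in s -> c f = 0].

Definition nonconstant f : Prop := forall y, exists x, f x != y.

Lemma expands_inB s f g : expands_in s f -> expands_in s g ->
  expands_in s (f \- g).
Proof.
move=> [th [w [c ->]]] [th' [w' [c' ->]]].
exists (th - th'), (fun j => w j - w' j), (fun f => c f - c' f);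
  apply/funext => x.
rewrite /expansion /=; under [X in _ = _ + X + _]eq_bigr do rewrite mulrBl.
under [X in _ = _ + X]eq_bigr do rewrite mulrBl.
by rewrite !sumrB; ring.
Qed.

Lemma expands_in_cst s y : expands_in s (cst y).
Proof.
exists y, (fun=> 0), (fun=> 0); apply/funext => x; rewrite /expansion.
by rewrite !big1 ?addr0 // => *; rewrite mul0r.
Qed.

Lemma expansion_eq0 s th w c x : th = 0 -> (forall j, w j = 0) ->
  (forall f, f \in s -> c f = 0) -> expansion s th w c x = 0.
Proof.
move=> -> w0 c0; rewrite /expansion add0r big1 => [|j _];
  last by rewrite w0 mul0r.
by rewrite add0r big_seq big1 // => f /c0 ->; rewrite mul0r.
Qed.

Lemma expands_in_dense_neq0 s f : locally_free s -> expands_in s f ->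
  (exists x, f x != 0) -> dense [set x | f x != 0].
Proof.
move=> s_free [th [w [c ->]]] [x0 x0_neq] U U0 oU; apply: contrapT => U_vanish.
have [|th0 w0 c0] := s_free U th w c oU U0.
  by move=> x Ux; apply/eqP/negP => /negP neq; apply: U_vanish; exists x.
by move: x0_neq; rewrite expansion_eq0 ?eqxx.
Qed.

Lemma expansion_continuous s th w c :
  (forall f, f \in s -> continuous f) -> continuous (expansion s th w c).
Proof.
move=> s_cont; have -> : expansion s th w c =
    cst th + (fun x : 'cV[R]_D => \sum_j w j * x j 0) +
    (fun x : 'cV[R]_D => \sum_(f <- s | f \in s) c f * sigma (f x)).
  by apply/funext => x; rewrite /expansion [X in _ + X = _]big_seq.
move=> x; apply: continuousD; first apply: continuousD.
- exact: cst_continuous.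
- apply: continuous_big => [|j _ y]; first exact: add_continuous.
  by apply: continuousM; [exact: cst_continuous|exact: coord_continuous].
apply: continuous_big => [|f fs y]; first exact: add_continuous.
apply: continuousM; first exact: cst_continuous.
by apply: continuous_comp; [exact: s_cont|exact: sigma_cont].
Qed.

Definition cons_unit a s (k : option 'I_(size s)) : E :=
  if k is Some i then tnth (in_tuple s) i else a.

Lemma mem_cons_unit a s (k : option 'I_(size s)) : cons_unit a k \in a :: s.
Proof. by case: k => [i|]; rewrite in_cons ?eqxx //= mem_tnth orbT. Qed.

Lemma cons_unit_inj a s : uniq (a :: s) -> injective (@cons_unit a s).
Proof.
move=> /= /andP[a_s /(tuple_uniqP (in_tuple s)) s_inj] [i|] [j|] //= eq_unit.
- by rewrite (s_inj _ _ eq_unit).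
- by move: a_s; rewrite -eq_unit mem_tnth.
- by move: a_s; rewrite eq_unit mem_tnth.
Qed.

Lemma separating_samples s a U M :
  uniq (a :: s) -> locally_free s -> (forall f, f \in a :: s -> continuous f) ->
  (forall f, f \in a :: s -> nonconstant f) ->
  (forall f, f \in a :: s -> expands_in s f) -> open U -> U !=set0 ->
  exists X, [/\ size X = M, forall m, (m < M)%N -> U (sample_point R X m) &
    injective (fun q : 'I_M * option 'I_(size s) =>
      cons_unit a q.2 (sample_point R X q.1))].
Proof.
move=> uniq_as s_free as_cont as_nonconst as_exp oU U0.
apply: separating_rational_points => // [k|k k' neq|k y].
- exact/as_cont/mem_cons_unit.
- apply: (@expands_in_dense_neq0 s (cons_unit a k \- cons_unit a k')) => //.
    by apply: expands_inB; exact/as_exp/mem_cons_unit.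
  apply: contrapT => /forallNP eq_units; move: neq; apply/negP; rewrite negbK.
  apply/eqP/(cons_unit_inj uniq_as)/funext => x; apply/eqP; rewrite -subr_eq0.
  by rewrite -[_ == 0]negbK; apply/negP/eq_units.
- apply: (@expands_in_dense_neq0 s (cons_unit a k \- cst y)) => //.
    by apply: expands_inB (expands_in_cst _ _); exact/as_exp/mem_cons_unit.
  have [x neq] := as_nonconst _ (mem_cons_unit a k) y.
  by exists x; rewrite /= subr_eq0.
Qed.

Lemma no_relation s a U th w c :
  uniq (a :: s) -> locally_free s -> (forall f, f \in a :: s -> continuous f) ->
  (forall f, f \in a :: s -> nonconstant f) ->
  (forall f, f \in a :: s -> expands_in s f) -> open U -> U !=set0 ->
  ~ (forall x, U x -> sigma (a x) = expansion s th w c x).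
Proof.
move=> uniq_as s_free as_cont as_nonconst as_exp oU U0 relation.
have [X [sX XU X_inj]] := separating_samples (num_samples D (size s))
  uniq_as s_free as_cont as_nonconst as_exp oU U0.
have /choice[coefs coefsE] (k : option 'I_(size s)) :
    exists d : R * ('I_D -> R) * (E -> R),
      cons_unit a k = expansion s d.1.1 d.1.2 d.2.
  have [th' [w' [c' bE]]] := as_exp _ (mem_cons_unit a k).
  by exists (th', w', c').
pose d k := if k is Some k' then coefs k' else (th, w, c).
pose t (p : relation_unknown D (size s)) : R := match p with
  | inl (k, None) => (d k).1.1
  | inl (k, Some (inl j)) => (d k).1.2 j
  | inl (k, Some (inr i)) => (d k).2 (tnth (in_tuple s) i)
  | inr (m, i) => sigma (tnth (in_tuple s) i (sample_point R X m))
  end.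
have formE m k : relation_form X t m k =
    expansion s (d k).1.1 (d k).1.2 (d k).2 (sample_point R X m).
  by rewrite /relation_form /expansion [X in _ = _ + X]big_tnth.
have argE q : relation_argument X t q = cons_unit a q.2 (sample_point R X q.1).
  by rewrite /relation_argument formE coefsE.
have [|[m [i|]]] := sigma_generic (X := X) (t := t).
- by move=> q q' /=; rewrite !argE => /X_inj; case: q q' => [? ?] [? ?].
- by rewrite /residual /= argE /relation_value /= subrr eqxx.
rewrite /residual /= argE /relation_value /= formE /= relation ?subrr ?eqxx //.
exact: XU.
Qed.

End Expansions.

(** * Circuits *)

Section Circuits.
Context (R : realType) (D : nat) (sigma : R -> R).
Context (sigma_cont : continuous sigma).
Context (sigma_generic : generic_activation D sigma).
Local Notation E := ('cV[R]_D -> R).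
Local Notation expands_in := (@expands_in R D sigma).
Local Notation expansion := (@expansion R D sigma).
Local Notation locally_free := (@locally_free R D sigma).
Implicit Types (s : seq E) (f a : E) (c : E -> R) (th : R) (w : 'I_D -> R).

Fixpoint circuit s : Prop :=
  if s is a :: s' then
    [/\ circuit s', a \notin s', nonconstant a & expands_in s' a]
  else True.

Lemma circuit_uniq s : circuit s -> uniq s.
Proof. by elim: s => //= a s IH [/IH -> ->]. Qed.

Lemma circuit_nonconstant s f : circuit s -> f \in s -> nonconstant f.
Proof.
elim: s => // a s IH [cs _ a_nonconst _]; rewrite in_cons => /predU1P[-> //|].
exact: IH.
Qed.

Lemma circuit_continuous s f : circuit s -> f \in s -> continuous f.
Proof.
elim: s f => // a s IH f [cs _ _ [th [w [c ->]]]].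
rewrite in_cons => /predU1P[->|]; last exact: IH.
by apply: expansion_continuous => // g; exact: IH.
Qed.

Lemma expands_in_sub s s' f : uniq s -> uniq s' -> {subset s <= s'} ->
  expands_in s f -> expands_in s' f.
Proof.
move=> us us' ss' [th [w [c ->]]];
  exists th, w, (fun g => if g \in s then c g else 0).
apply/funext => x; rewrite /expansion; congr (_ + _).
under [RHS]eq_bigr => g _ do rewrite (fun_if (fun y => y * sigma (g x))) mul0r.
rewrite -big_mkcond -big_filter; apply: perm_big; apply: uniq_perm => //.
  by rewrite filter_uniq.
by move=> g; rewrite mem_filter; case: (boolP (g \in s)) => // /ss' ->.
Qed.

Lemma circuit_expands_in s s' f : circuit s -> f \in s -> uniq s' ->
  {subset behead s <= s'} -> expands_in s' f.
Proof.
move=> cs fs us'; elim: s cs fs => // a s IH [cs _ _ a_exp] fs ss'.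
move: fs; rewrite in_cons => /predU1P[->|fs].
  exact: expands_in_sub (circuit_uniq cs) us' ss' a_exp.
by apply: IH => // g /mem_behead; exact: ss'.
Qed.

Lemma affine_locally_free : locally_free [::].
Proof.
move=> U th w c oU [x Ux] vanish.
have affine0 y : U y -> th + \sum_j w j * y j 0 = 0.
  by move=> /vanish; rewrite /expansion big_nil addr0.
have /nbhs_ballP[r /= r0 Ur] : nbhs x U by exact: open_nbhs_nbhs.
have w0 j : w j = 0.
  pose y := x + (r / 2) *: delta_mx j 0 : 'cV[R]_D.
  have Uy : U y.
    apply: Ur; split=> // i k.
    rewrite !mxE /ball /= opprD addNKr normrN ord1 eqxx andbT.
    case: (i == j); rewrite ?mulr1 ?mulr0 ?normr0 // gtr0_norm ?divr_gt0 //.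
    by rewrite ltr_pdivrMr // ltr_pMr // ltr1n.
  have : \sum_i w i * y i 0 - \sum_i w i * x i 0 = 0.
    by have := affine0 x Ux; have := affine0 y Uy; lra.
  rewrite -sumrB (bigD1 j) //= big1 ?addr0 => [|i ij].
    rewrite -mulrBr !mxE !eqxx addrAC subrr add0r mulr1 => /eqP.
    by rewrite mulf_eq0 => /orP[/eqP //|]; rewrite gt_eqF ?divr_gt0.
  by rewrite -mulrBr !mxE (negbTE ij) /= mulr0 addr0 subrr mulr0.
split=> //; have := affine0 x Ux; rewrite big1 ?addr0 // => j _.
by rewrite w0 mul0r.
Qed.

Lemma circuit_locally_free s : circuit s -> locally_free s.
Proof.
elim: s => [_|a s IH cas]; first exact: affine_locally_free.
have [cs _ _ _] := cas; have us := circuit_uniq cs.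
move=> U th w c oU U0 vanish.
have expansion_cons x : expansion (a :: s) th w c x =
    c a * sigma (a x) + expansion s th w c x.
  by rewrite /expansion big_cons; ring.
have ca0 : c a = 0.
  apply/eqP/negP => /negP ca.
  apply: (@no_relation _ _ _ sigma_generic s a U (- th / c a)
      (fun j => - w j / c a) (fun f => - c f / c a)) => //.
  - exact: circuit_uniq cas.
  - exact: IH.
  - by move=> f; exact: circuit_continuous.
  - by move=> f; exact: circuit_nonconstant.
  - by move=> f fas; exact: circuit_expands_in cas fas us _.
  move=> x /vanish/eqP; rewrite expansion_cons addr_eq0 => /eqP relation.
  have -> : sigma (a x) = - expansion s th w c x / c a.
    by rewrite -relation mulrC mulKf.
  rewrite /expansion !opprD !mulrDl -!sumrN !mulr_suml.
  by congr (_ + _ + _); apply: eq_bigr => i _; ring.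
have [|th0 w0 c0] := IH cs U th w c oU U0.
  by move=> x /vanish; rewrite expansion_cons ca0 mul0r add0r.
by split=> // f; rewrite in_cons => /predU1P[->|/c0].
Qed.

Lemma circuit_merge s s' : circuit s -> circuit s' ->
  exists2 r, circuit r & {subset s ++ s' <= r}.
Proof.
move=> cs; elim: s' => [_|a s' IH]; first by exists s => // f; rewrite cats0.
move=> cas'; have [cs' _ a_nonconst _] := cas'; have [r cr ss'r] := IH cs'.
have sr : {subset s <= r} by move=> f fs; apply: ss'r; rewrite mem_cat fs.
have s'r : {subset s' <= r}.
  by move=> f fs'; apply: ss'r; rewrite mem_cat fs' orbT.
have [ar|a_r] := boolP (a \in r).
  by exists r => // f; rewrite mem_cat in_cons => /or3P[/sr|/eqP ->|/s'r].
exists (a :: r).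
  split=> //; apply: (circuit_expands_in cas') => //; first exact: mem_head.
  exact: circuit_uniq.
move=> f; rewrite mem_cat in_cons [f \in a :: r]in_cons.
by case/or3P => [/sr ->|->|/s'r ->]; rewrite ?orbT.
Qed.

Definition circuit_function f : Prop := exists2 s, circuit s & f \in s.

Lemma circuit_functions_merge (I : finType) (a : I -> E) :
  (forall i, circuit_function (a i)) ->
  exists2 s, circuit s & forall i, a i \in s.
Proof.
move=> a_circuit.
suff [s cs a_s] : exists2 s, circuit s & forall i, i \in enum I -> a i \in s.
  by exists s => // i; apply: a_s; rewrite mem_enum.
elim: (enum I) => [|i r [s cs IH]]; first by exists [::].
have [s' cs' ais'] := a_circuit i; have [r' cr' sub] := circuit_merge cs cs'.
exists r' => // j; rewrite in_cons => /predU1P[->|/IH ajs]; apply: sub.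
  by rewrite mem_cat ais' orbT.
by rewrite mem_cat ajs.
Qed.

Definition family_expansion (I : finType) (a : I -> E) th w (k : I -> R) : E :=
  fun x => th + \sum_j w j * x j 0 + \sum_i k i * sigma (a i x).

Definition total_weight (I : finType) (a : I -> E) (k : I -> R) f : R :=
  \sum_(i | a i == f) k i.

Lemma family_expansionE (I : finType) (a : I -> E) s th w k :
  uniq s -> (forall i, a i \in s) ->
  family_expansion a th w k = expansion s th w (total_weight a k).
Proof.
move=> us ais; apply/funext => x; congr (_ + _).
under [RHS]eq_bigr do rewrite mulr_suml.
rewrite (exchange_big_dep predT) //=; apply: eq_bigr => i _.
rewrite big_mkcond (bigD1_seq (a i)) //= eqxx big1 ?addr0 // => f fai.
by rewrite eq_sym (negbTE fai).
Qed.

Lemma family_expansion_eq0 (I : finType) (a : I -> E) th w k :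
  (forall i, circuit_function (a i)) ->
  family_expansion a th w k =1 (fun=> 0) ->
  [/\ th = 0, forall j, w j = 0 & forall f, total_weight a k f = 0].
Proof.
move=> a_circuit vanish; have [s cs ais] := circuit_functions_merge a_circuit.
have [|x _|th0 w0 c0] := circuit_locally_free cs (U := setT) (th := th) (w := w)
    (c := total_weight a k) openT.
- by exists 0.
- by rewrite -family_expansionE ?vanish //; exact: circuit_uniq.
split=> // f; have [/c0 //|fs] := boolP (f \in s).
by apply: big1 => i /eqP aif; rewrite -aif ais in fs.
Qed.

Lemma family_expansion_inj (I I' : finType) (a : I -> E) (a' : I' -> E)
    th th' w w' k k' :
  (forall i, circuit_function (a i)) -> (forall i, circuit_function (a' i)) ->
  family_expansion a th w k = family_expansion a' th' w' k' ->
  [/\ th = th', w =1 w' & total_weight a k =1 total_weight a' k'].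
Proof.
move=> a_circuit a'_circuit eq_exp.
pose b (i : I + I') := match i with inl i => a i | inr i => a' i end.
pose l (i : I + I') := match i with inl i => k i | inr i => - k' i end.
have [[] //|x|th0 w0 c0] :=
    @family_expansion_eq0 _ b (th - th') (fun j => w j - w' j) l.
  rewrite -(subrr (family_expansion a' th' w' k' x)) -{1}eq_exp.
  rewrite /family_expansion big_sumType /=; under eq_bigr do rewrite mulrBl.
  under [X in _ + (_ + X)]eq_bigr do rewrite mulNr.
  by rewrite sumrB sumrN; ring.
split=> [|j|f]; apply/eqP; rewrite -subr_eq0 ?th0 ?w0 //.
by have := c0 f; rewrite /total_weight big_sumType /= sumrN => ->.
Qed.

Lemma family_expansion_circuit (I : finType) (a : I -> E) th w k :
  (forall i, circuit_function (a i)) ->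
  nonconstant (family_expansion a th w k) ->
  circuit_function (family_expansion a th w k).
Proof.
move=> a_circuit; have [s cs ais] := circuit_functions_merge a_circuit.
have us := circuit_uniq cs.
rewrite (family_expansionE th w k us ais) => nonconst.
set b := expansion _ _ _ _ in nonconst *.
have [bs|b_s] := boolP (b \in s); first by exists s.
exists (b :: s); last exact: mem_head.
by split=> //; exists th, w, (total_weight a k).
Qed.

Lemma total_weight_inj (I : finType) (a : I -> E) (k : I -> R) i :
  injective a -> total_weight a k (a i) = k i.
Proof. by move=> a_inj; apply: big_pred1 => j; exact: inj_eq. Qed.

End Circuits.

(** * Networks *)

Section Networks.
Context (R : realType) (D : nat) (sigma : R -> R).
Context (sigma_cont : continuous sigma).
Context (sigma_generic : generic_activation D sigma).
Local Notation E := ('cV[R]_D -> R).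
Implicit Types N : nc_network R D.

Definition preactivation N l (j : 'I_(width N l.+1)) : E := fun x =>
  (weight N l *m
     layer_output sigma (castmx (esym (width_in N), erefl 1%N) x) l +
   bias N l) j 0.

(* A unit of layer [l + 1] is fed by the inputs if [l = 0] and by the units of
   layer [l] otherwise. *)
Definition fan_in N l : nat := if l is l'.+1 then width N l'.+1 else 0%N.

Definition prev_preactivation N l : 'I_(fan_in N l) -> E :=
  match l with 0 => fun=> cst 0 | l'.+1 => @preactivation N l' end.

Definition input_part N l : 'rV[R]_(width N l) -> 'I_D -> R :=
  match l with
  | 0 => fun v k => v 0 (cast_ord (esym (width_in N)) k)
  | l'.+1 => fun _ _ => 0
  end.

Definition unit_part N l : 'rV[R]_(width N l) -> 'I_(fan_in N l) -> R :=
  match l with 0 => fun _ _ => 0 | l'.+1 => fun v i => v 0 i end.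

Definition layer_form N l th (v : 'rV[R]_(width N l)) : E :=
  family_expansion sigma (@prev_preactivation N l) th
    (input_part v) (unit_part v).

Lemma preactivationE N l (j : 'I_(width N l.+1)) :
  preactivation j = layer_form (bias N l j 0) (row j (weight N l)).
Proof.
apply/funext => x; rewrite /layer_form /family_expansion -addrA addrC.
rewrite /preactivation !mxE; congr (_ + _).
case: l j => [|l] j /=.
  rewrite big_ord0 addr0.
  rewrite (reindex (cast_ord (esym (width_in N)))) /=; last first.
    by apply: onW_bij; exists (cast_ord (width_in N)) => i; exact: val_inj.
  apply: eq_bigr => k _; rewrite mxE castmxE.
  by congr (_ * x _ _); exact: val_inj.
rewrite [X in _ = X + _]big1 ?add0r => [|k _]; last by rewrite mul0r.
by apply: eq_bigr => i _; rewrite /preactivation !mxE.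
Qed.

Lemma row_parts_inj N l (v v' : 'rV[R]_(width N l)) :
  input_part v =1 input_part v' -> unit_part v =1 unit_part v' -> v = v'.
Proof.
case: l v v' => [|l] v v' /= in_eq unit_eq; apply/rowP => k //.
by have := in_eq (cast_ord (width_in N) k); rewrite cast_ordK.
Qed.

Lemma layer_form0 N l th : @layer_form N l th 0 = cst th.
Proof.
apply/funext => x; rewrite /layer_form /family_expansion; case: l => [|l] /=;
  by rewrite !big1 ?addr0 // => k _; rewrite ?mxE mul0r.
Qed.

Lemma layer_form_inj N l th th' (v v' : 'rV[R]_(width N l)) :
  (forall i, circuit_function sigma (@prev_preactivation N l i)) ->
  injective (@prev_preactivation N l) ->
  layer_form th v = layer_form th' v' -> th = th' /\ v = v'.
Proof.
move=> prev_circuit prev_inj form_eq.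
have [-> in_eq weight_eq] :=
  family_expansion_inj sigma_cont sigma_generic prev_circuit prev_circuit
    form_eq.
split=> //; apply: row_parts_inj => // i.
by have := weight_eq (prev_preactivation i); rewrite !total_weight_inj.
Qed.

Lemma layer_circuit_inj N l : (l < depth N)%N ->
  (forall i, circuit_function sigma (@prev_preactivation N l i)) ->
  injective (@prev_preactivation N l) ->
  (forall j : 'I_(width N l.+1), circuit_function sigma (preactivation j)) /\
  injective (@preactivation N l).
Proof.
move=> ld prev_circuit prev_inj; split=> [j|j j' jj'].
  rewrite preactivationE; apply: family_expansion_circuit => // y.
  apply: contrapT => const.
  have : layer_form (bias N l j 0) (row j (weight N l)) = @layer_form N l y 0.
    rewrite layer_form0; apply/funext => x.
    by apply/eqP/negPn/negP => neq; apply: const; exists x.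
  move=> /(layer_form_inj prev_circuit prev_inj)[_ /eqP].
  exact/negP/weight_row_neq0.
apply/eqP/negPn/negP => neq; apply: (@nc_no_clones _ _ N l j j' ld neq).
by move: jj'; rewrite !preactivationE =>
  /(layer_form_inj prev_circuit prev_inj)[-> ->].
Qed.

Lemma preactivation_circuit_inj N l : (l < depth N)%N ->
  (forall j : 'I_(width N l.+1), circuit_function sigma (preactivation j)) /\
  injective (@preactivation N l).
Proof.
elim: l => [|l IH] ld; first by apply: layer_circuit_inj => //; case.
by have [circuit_l inj_l] := IH (ltnW ld); exact: layer_circuit_inj.
Qed.

Lemma prev_preactivation_circuit_inj N l : (l < depth N)%N ->
  (forall i, circuit_function sigma (@prev_preactivation N l i)) /\
  injective (@prev_preactivation N l).
Proof.
case: l => [|l] ld; first by split; case.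
exact: preactivation_circuit_inj (ltnW ld).
Qed.

Lemma preactivation_eq N N' l l'
    (j : 'I_(width N l.+1)) (j' : 'I_(width N' l'.+1)) :
  (l < depth N)%N -> (l' < depth N')%N -> preactivation j = preactivation j' ->
  [/\ bias N l j 0 = bias N' l' j' 0,
    input_part (row j (weight N l)) =1 input_part (row j' (weight N' l')) &
    total_weight (@prev_preactivation N l) (unit_part (row j (weight N l))) =1
    total_weight (@prev_preactivation N' l')
      (unit_part (row j' (weight N' l')))].
Proof.
move=> ld l'd'; rewrite !preactivationE; apply: family_expansion_inj => //.
  by have [] := prev_preactivation_circuit_inj ld.
by have [] := prev_preactivation_circuit_inj l'd'.
Qed.

Definition layers_match N N' l l' : Prop :=
  forall j : 'I_(width N l.+1), exists j' : 'I_(width N' l'.+1),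
    preactivation j = preactivation j'.

Lemma layers_match_pred N N' l l' :
  (l.+1 < depth N)%N -> (l'.+1 < depth N')%N ->
  layers_match N N' l.+1 l'.+1 -> layers_match N N' l l'.
Proof.
move=> ld l'd' match_l i.
have [j wji] : exists j, weight N l.+1 j i != 0.
  apply/existsP; have := @weight_col_neq0 _ N l.+1 i ld.
  apply: contraR => /existsPn wi0.
  by apply/eqP/colP => j; rewrite !mxE; apply/eqP; rewrite -[_ == _]negbK wi0.
have [j' jj'] := match_l j.
have [_ _ /(_ (preactivation i))] := preactivation_eq ld l'd' jj'.
have [_ prev_inj] := preactivation_circuit_inj (ltnW ld).
rewrite (total_weight_inj (a := @preactivation N l)) //= mxE => wE.
apply: contrapT => /forallNP no_match; move/eqP: wji; apply; rewrite wE.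
by apply: big1 => i' /eqP eq_pre; case: (no_match i').
Qed.

Lemma layers_match_down N N' l l' k :
  (l < depth N)%N -> (l' < depth N')%N -> (k <= l)%N -> (k <= l')%N ->
  layers_match N N' l l' -> layers_match N N' (l - k) (l' - k).
Proof.
move=> ld l'd' kl kl' match_l.
elim: k kl kl' => [|k IH] kl kl'; first by rewrite !subn0.
have := IH (ltnW kl) (ltnW kl'); rewrite -!(subSS k) !subSn //.
by apply: layers_match_pred;
  rewrite -subSn // subSS (leq_ltn_trans (leq_subr _ _)).
Qed.

Lemma width_gt0 N l : (l <= depth N)%N -> (0 < width N l)%N.
Proof.
move=> ld; apply: (@layout_gt0 _ N); apply: mem_nth.
have := depth_ge1 N; move: ld; rewrite /depth.
by case: size => //= n; rewrite ltnS.
Qed.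

Lemma preactivation0_neqS N N' l'
    (j : 'I_(width N 1)) (j' : 'I_(width N' l'.+2)) :
  (l'.+1 < depth N')%N -> preactivation j <> preactivation j'.
Proof.
move=> l'd' jj'; have d0 : (0 < depth N)%N := depth_ge1 N.
have [_ input_eq _] := preactivation_eq d0 l'd' jj'.
have := @weight_row_neq0 _ N 0 j d0; move/eqP; apply.
by apply: row_parts_inj => [k|[]//]; rewrite input_eq /= mxE.
Qed.

Lemma layers_match_depth N N' l l' :
  depth N = l.+1 -> depth N' = l'.+1 -> layers_match N N' l l' -> (l' <= l)%N.
Proof.
move=> dN dN' match_l; rewrite leqNgt; apply/negP => ll'.
have := layers_match_down (k := l) _ _ (leqnn l) (ltnW ll') match_l.
rewrite dN dN' subnn -(subnSK ll') => /(_ (ltnSn _) (ltnSn _)).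
have w0 : (0 < width N 1)%N by rewrite width_gt0 // depth_ge1.
move=> /(_ (Ordinal w0))[j'].
by apply: preactivation0_neqS; rewrite dN' ltnS subnSK // leq_subr.
Qed.

Lemma layers_match_width N N' l : (l < depth N)%N ->
  layers_match N N' l l -> (width N l.+1 <= width N' l.+1)%N.
Proof.
move=> ld match_l; have [_ pre_inj] := preactivation_circuit_inj ld.
have [h hE] := choice match_l; rewrite -[leqLHS]card_ord -[leqRHS]card_ord.
by apply: (@leq_card _ _ h) => j1 j2 hj; apply: pre_inj; rewrite !hE hj.
Qed.

Lemma layers_match_all N N' L l :
  depth N = L.+1 -> depth N' = L.+1 -> layers_match N N' L L -> (l <= L)%N ->
  layers_match N N' l l.
Proof.
move=> dN dN' match_L lL; rewrite -(subKn lL).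
by apply: layers_match_down; rewrite ?dN ?dN' ?leq_subr.
Qed.

Lemma layers_match_layout N N' L :
  depth N = L.+1 -> depth N' = L.+1 ->
  layers_match N N' L L -> layers_match N' N L L -> layout N = layout N'.
Proof.
move=> dN dN' match_NN' match_N'N.
have size_layout M : depth M = L.+1 -> size (layout M) = L.+2.
  by rewrite /depth; have := depth_ge1 M; case: size => //= n _ ->.
apply: (@eq_from_nth _ 0%N) => [|[_|l]]; rewrite ?size_layout //.
  exact: etrans (width_in N) (esym (width_in N')).
rewrite !ltnS => lL; apply/eqP; rewrite eqn_leq; apply/andP; split.
  by apply: layers_match_width (layers_match_all dN dN' match_NN' lL);
    rewrite dN ltnS.
by apply: layers_match_width (layers_match_all dN' dN match_N'N lL);
  rewrite dN' ltnS.
Qed.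

Definition cast_unit N N' (eqD : layout N = layout N') l :
    'I_(width N l) -> 'I_(width N' l) :=
  cast_ord (congr1 (fun layers => nth 0%N layers l) eqD).

Lemma cast_unit_inj N N' (eqD : layout N = layout N') l :
  injective (@cast_unit N N' eqD l).
Proof. exact: cast_ord_inj. Qed.

Lemma layers_match_perm N N' (eqD : layout N = layout N') l :
  (l < depth N')%N ->
  layers_match N' N l l -> exists g : {perm 'I_(width N l.+1)},
    forall j, preactivation (cast_unit eqD j) = preactivation (g j).
Proof.
move=> ld match_l; have [h hE] := choice (fun j => match_l (cast_unit eqD j)).
have h_inj : injective h.
  move=> j1 j2 hj; have [_ pre_inj] := preactivation_circuit_inj ld.
  by apply: (@cast_unit_inj N N' eqD); apply: pre_inj; rewrite !hE hj.
by exists (perm h_inj) => j; rewrite permE.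
Qed.

Lemma matched_unit_weights N N' (eqD : layout N = layout N')
    (g : forall l, {perm 'I_(width N l)}) l (j : 'I_(width N l.+1)) :
  g 0%N = 1%g -> (l < depth N)%N -> (l < depth N')%N ->
  (forall l' j', (l' <= l)%N ->
     preactivation (cast_unit eqD j') = preactivation (g l'.+1 j')) ->
  bias N' l (cast_unit eqD j) 0 = bias N l (g l.+1 j) 0 /\
  forall k, weight N' l (cast_unit eqD j) (cast_unit eqD k) =
    weight N l (g l.+1 j) (g l k).
Proof.
move=> g0 ld l'd g_match.
have [bE input_eq weight_eq] := preactivation_eq l'd ld (g_match l j (leqnn l)).
split=> // {bE} k; have [_ prev_inj] := prev_preactivation_circuit_inj ld.
have [_ prev_inj'] := prev_preactivation_circuit_inj l'd.
case: l => [|l] in j k ld l'd g_match input_eq weight_eq prev_inj prev_inj' *.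
  have := input_eq (cast_ord (width_in N) k).
  rewrite g0 perm1 /= !mxE cast_ordK.
  by move=> <-; congr (weight N' 0%N _ _); exact: val_inj.
have := weight_eq (preactivation (cast_unit eqD k)).
rewrite (total_weight_inj (a := @preactivation N' l)) //.
rewrite (g_match l k (leqnSn l)).
by rewrite (total_weight_inj (a := @preactivation N l)) //= !mxE.
Qed.

Lemma ord_eq_of1 n (i j : 'I_n) : n = 1%N -> i = j.
Proof. by move=> n1; subst n; rewrite !ord1. Qed.

Lemma layers_match_isomorphic N N' L :
  depth N = L.+1 -> depth N' = L.+1 ->
  layers_match N N' L L -> layers_match N' N L L -> isomorphic N N'.
Proof.
move=> dN dN' match_NN' match_N'N.
have eqD := layers_match_layout dN dN' match_NN' match_N'N.
have g_ex l : exists g : {perm 'I_(width N l.+1)}, (l <= L)%N -> forall j,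
    preactivation (cast_unit eqD j) = preactivation (g j).
  have [lL|_] := leqP l L; last by exists 1%g.
  have ld' : (l < depth N')%N by rewrite dN' ltnS.
  have [g gE] :=
    layers_match_perm eqD ld' (layers_match_all dN' dN match_N'N lL).
  by exists g.
pose g l : {perm 'I_(width N l)} :=
  match l with 0 => 1%g | l'.+1 => projT1 (cid (g_ex l')) end.
have gE l j : (l <= L)%N ->
    preactivation (cast_unit eqD j) = preactivation (g l.+1 j).
  by move=> lL; exact: (projT2 (cid (g_ex l)) lL).
exists eqD, g; split=> //.
  by apply/permP => j; exact: ord_eq_of1 (width_out N).
move=> l ld j; apply: matched_unit_weights => //.
  by rewrite dN' -dN.
by move=> l' j' l'l; apply: gE; rewrite -ltnS -dN (leq_ltn_trans l'l).
Qed.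

Lemma nc_realizationE N : exists l (j : 'I_(width N l.+1)),
  depth N = l.+1 /\ nc_realization sigma N = sigma \o preactivation j.
Proof.
have dE : depth N = (depth N).-1.+1 by rewrite prednK //; exact: depth_ge1.
exists (depth N).-1; rewrite /nc_realization /realization.
move: (depth N) (depth N).-1 (width_out N) dE => d l e dE; subst d.
exists (cast_ord (esym e) 0); split=> //; apply/funext => x.
by rewrite /= castmxE mxE; congr (sigma (_ _ _)); exact: val_inj.
Qed.

Lemma output_preactivation_isomorphic N N' l l'
    (j : 'I_(width N l.+1)) (j' : 'I_(width N' l'.+1)) :
  depth N = l.+1 -> depth N' = l'.+1 -> preactivation j = preactivation j' ->
  isomorphic N N'.
Proof.
move=> dN dN' jj'.
have output_unit (M : nc_network R D) m (i i' : 'I_(width M m.+1)) :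
    depth M = m.+1 -> i = i'.
  by move=> dM; have := width_out M; rewrite dM; exact: ord_eq_of1.
have match_NN' : layers_match N N' l l'.
  by move=> i; exists j'; rewrite (output_unit _ _ i j dN).
have match_N'N : layers_match N' N l' l.
  by move=> i; exists j; rewrite (output_unit _ _ i j' dN').
have ll' : l = l'.
  apply/eqP; rewrite eqn_leq (layers_match_depth dN dN') // andbT.
  exact: layers_match_depth dN' dN match_N'N.
by subst l'; exact: layers_match_isomorphic dN dN' match_NN' match_N'N.
Qed.

Theorem nc_realizations_independent n (N : 'I_n -> nc_network R D) :
  (forall i j, i != j -> ~ isomorphic (N i) (N j)) ->
  linearly_independent (with_one (fun j => nc_realization sigma (N j))).
Proof.
move=> noniso c c0.
have /choice[a aP] i : exists a : E, [/\ circuit_function sigma a,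
    nc_realization sigma (N i) = sigma \o a &
    exists l (j : 'I_(width (N i) l.+1)),
      depth (N i) = l.+1 /\ a = preactivation j].
  have [l [j [d realE]]] := nc_realizationE (N i).
  exists (preactivation j); split=> //.
    have ld : (l < depth (N i))%N by rewrite d.
    by have [] := preactivation_circuit_inj ld.
  by exists l, j.
have a_inj : injective a.
  move=> i i' ii'; apply/eqP/negPn/negP => neq; apply: (noniso _ _ neq).
  have [_ _ [l [j [d aE]]]] := aP i; have [_ _ [l' [j' [d' a'E]]]] := aP i'.
  apply: output_preactivation_isomorphic d d' _.
  exact: etrans (esym aE) (etrans ii' a'E).
have [i|x|c_None _ c_Some] := @family_expansion_eq0 _ _ _ sigma_cont
    sigma_generic _ a (c None) (fun=> 0) (fun i => c (Some i)).
- by have [] := aP i.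
- have := congr1 (fun f => f x) c0; rewrite fct_sumE (bigD1 None) //=.
  rewrite (reindex_omap Some id) /=; last by case.
  under eq_bigl do rewrite eqxx.
  move=> vanish; rewrite /family_expansion.
  rewrite [X in _ + X + _]big1 ?addr0 => [|k _]; last by rewrite mul0r.
  apply: etrans vanish; congr (_ + _); first by rewrite -[LHS]mulr1.
  by apply: eq_bigr => i _; have [_ -> _] := aP i.
by case=> [i|//]; have := c_Some (a i); rewrite total_weight_inj.
Qed.

End Networks.

(** * Generic holomorphic approximation *)

Lemma norm_Linfty_le (R : realType) (f : R -> R) (e : R) :
  0 <= e -> (forall x, `|f x| <= e) -> (norm_Linfty f <= e%:E)%E.
Proof.
move=> e0 fe; rewrite /norm_Linfty unlock.
case: ifP => _; last by rewrite lee_fin.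
by apply/ess_supP; apply: aeW => x; rewrite /= lee_fin.
Qed.

Lemma derivable_meromorphic (R : realType) (D : set R[i]^o)
    (f : R[i]^o -> R[i]^o) :
  open D -> (forall z, D z -> derivable f z 1) -> meromorphic D set0 f.
Proof.
move=> oD fD; split=> // [z _ /(_ setT filterT)[y []] //|z Dz _].
by apply: (filterS (P := D)) => //; exact: open_nbhs_nbhs.
Qed.

Lemma generic_holomorphic_approximation (R : realType) (D : nat) (f : R -> R)
    (eps : R) :
  unif_continuous f ->
  cvg (f x @[x --> +oo]) -> cvg (f x @[x --> -oo]) -> 0 < eps ->
  exists (w : R) (sigma : R[i]^o -> R[i]^o),
    [/\ 0 < w, forall z, strip w z -> derivable sigma z 1, real_on_line sigma,
      forall x, `|f x - on_line sigma x| <= eps &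
      continuous (on_line sigma) /\ generic_activation D (on_line sigma)].
Proof.
move=> f_unif f_top f_bot eps0; have eps2 : 0 < eps / 2 by rewrite divr_gt0.
have [n [d [c0 [c [t [d0 d1 f_approx]]]]]] :=
  soft_step_approximation f_unif f_top f_bot eps2.
have stepL := klipschitz_soft_step_sum c0 c t d0; set k := \sum_k _ in stepL.
have k0 : 0 <= k by apply: sumr_ge0 => i _; rewrite mulr_ge0 // invr_ge0 ltW.
have [G [GC GR Ggen]] := generic_perturbation (0%N, [::])
  (fun p : nat * seq 'cV[rat]_D => @relation_system R D p.1 p.2)
  stepL k0 eps2.
have half_gt0 : 0 < 2^-1 :> R by rewrite invr_gt0.
have [_ GL] := C11_bound_on_line half_gt0 GC GR.
pose sigma (z : R[i]) : R[i] := complex_soft_step_sum d c0 c t z + G z.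
have sigma_real x : sigma x%:C = ((soft_step_sum d c0 c t \+ on_line G) x)%:C.
  by rewrite /sigma complex_soft_step_sum_real GR -rmorphD.
have lineE : on_line sigma = soft_step_sum d c0 c t \+ on_line G.
  by apply/funext => x; rewrite /on_line sigma_real.
exists (d / 2), sigma; rewrite lineE; split.
- by rewrite divr_gt0.
- move=> z zd; have zS : strip 2^-1 z.
    by apply: lt_le_trans zd _; rewrite ler_pdivrMr // mulVf.
  apply: derivableD; first exact: complex_soft_step_sum_derivable.
  exact: C11_bound_derivable (@strip_open _ _) GC zS.
- by move=> x; rewrite lineE.
- move=> x; have G_small : `|on_line G x| <= eps / 2.
    have Sx := strip_real x half_gt0; have [Gx _ _] := GC _ _ _ Sx Sx Sx.
    by rewrite -lecR -normc_real -GR.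
  rewrite opprD addrA (le_trans (ler_normB _ _)) // [leRHS]splitr.
  by rewrite lerD.
- split; first exact: klipschitz_continuous (klipschitzD stepL GL).
  by move=> u X; exact: (Ggen (u, X)).
Qed.

Theorem theorem2 (R : realType) (Din : nat) (rho : R -> R) (eps : R)
    (Din_gt0 : (0 < Din)%N)
    (rhoC1 : piecewise_C1 rho)
    (rhoBV : BV_line rho^`())
    (eps_gt0 : 0 < eps) :
  exists (D P : set R[i]^o) (sigma : R[i]^o -> R[i]^o),
    let sigmaR (x : R) : R := complex.Re (sigma x%:C) in
    [/\ meromorphic D P sigma,
        forall x : R, D x%:C /\ ~ P x%:C,
        forall x : R, sigma x%:C = (sigmaR x)%:C,
        (norm_Linfty (fun x : R => rho x - sigmaR x)%R < eps%:E)%E &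
        forall (n : nat) (N : 'I_n -> nc_network R Din),
          (forall i j, i != j -> ~ isomorphic (N i) (N j)) ->
          linearly_independent
            (with_one (fun j => nc_realization sigmaR (N j)))].
Proof.
have [rhoL1 _] := rhoBV.
have eps2 : 0 < eps / 2 by rewrite divr_gt0.
have [rho_top rho_bot] := piecewise_C1_cvg rhoC1 rhoL1.
have rho_unif := piecewise_C1_unif_continuous rhoC1 rhoL1.
have [w [sigma [w0 sigma_diff sigma_real rho_sigma [sigma_cont sigma_gen]]]] :=
  generic_holomorphic_approximation Din rho_unif rho_top rho_bot eps2.
exists (strip w), set0, sigma; split=> //.
- by apply: derivable_meromorphic sigma_diff; exact: strip_open.
- by move=> x; split=> //; exact: strip_real.
- have eps_half : ((eps / 2)%:E < eps%:E)%E.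
    by rewrite lte_fin ltr_pdivrMr // ltr_pMr // ltr1n.
  by apply: le_lt_trans eps_half; exact: norm_Linfty_le (ltW eps2) rho_sigma.
- by move=> n N; exact: nc_realizations_independent sigma_cont sigma_gen n N.
Qed.
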